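(* All star products of Wick type and all star products of anti-Wick type on a pseudo-K\''ahler manifold $(M,\omega,I)$ are of Vey type.
   Context: $(M,\omega,I)$ is a pseudo-K\''ahler manifold, $\dim_{\mathbb R}M=2n$: $g$ is a pseudo-Riemannian metric, $I$ is an almost complex structure that is a $g$-isometry and is parallel for the Levi-Civita connection $\nabla$ of $g$; then $M$ is a complex manifold and $\omega(X,Y)=g(IX,Y)$ is a symplectic form. All functions are smooth and complex-valued. In local holomorphic coordinates $Z_k=\partial_{z^k}$, $\overline Z_l=\partial_{\overline z^l}$, $\omega=\frac{\mathrm i}{2}g_{k\overline l}\,dz^k\wedge d\overline z^l$, $g^{k\overline l}g_{k\overline n}=\delta^{\overline l}_{\overline n}$, and $\{f,h\}=\frac{2}{\mathrm i}g^{k\overline l}(Z_k(f)\overline Z_l(h)-\overline Z_l(f)Z_k(h))$. $\mathcal O(U)$ and $\overline{\mathcal O}(U)$ denote holomorphic and anti-holomorphic functions on $U$. A star product on $(M,\omega,I)$ is a $\mathbb C[[\nu]]$-bilinear associative product $f\star h=\sum_{r\ge0}\nu^rC_r(f,h)$ on $\mathcal C^\infty(M)[[\nu]]$ with bidifferential operators $C_r$, $C_0(f,h)=fh$, $C_1(f,h)-C_1(h,f)=\{f,h\}$, and $C_r$ vanishing on constants for $r\ge1$. It is of Wick type (resp. anti-Wick type) if for all open $U\subseteq M$ and all $f,g,h,h'\in\mathcal C^\infty(M)$ with $h|_U\in\mathcal O(U)$, $h'|_U\in\overline{\mathcal O}(U)$ one has $f\star h|_U=fh|_U$ and $h'\star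 g|_U=h'g|_U$ (resp. $h\star f|_U=hf|_U$ and $g\star h'|_U=gh'|_U$). A star product is of Vey type if for every $r$ the bidifferential operator $C_r$ is of order $(r,r)$, i.e. of differential order at most $r$ in each argument. *)

(* Defs.v *)
From HB Require Import structures.
From mathcomp Require Import all_boot all_order all_algebra.
From mathcomp Require Import complex.
From mathcomp Require Import all_classical all_reals all_analysis.

Set Implicit Arguments.
Unset Strict Implicit.
Unset Printing Implicit Defensive.

Import Order.TTheory GRing.Theory Num.Theory.
Import numFieldNormedType.Exports.

Local Open Scope classical_set_scope.
Local Open Scope complex_scope.
Local Open Scope ring_scope.

(* The complex numbers are R[i] = R + iR for R : realType; a complex-valued
   function is differentiated through its real and imaginary parts. *)

Section SmoothManifolds.
Variables (R : realType) (m : nat).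

Definition iter_partial (s : seq 'I_m) (u : 'rV[R]_m -> R) : 'rV[R]_m -> R :=
  foldr (fun i v y => 'D_(delta_mx 0 i) v y) u s.

(* C^oo on W, for W open: partial derivatives of all orders exist on W and
   are (Frechet) differentiable there. *)
Definition smooth_on (W : set 'rV[R]_m) (u : 'rV[R]_m -> R) : Prop :=
  forall (s : seq 'I_m) (y : 'rV[R]_m), W y -> differentiable (iter_partial s u) y.

Variable M : topologicalType.

(* The maps are total; only their values on cdom, resp. on the image of cdom,
   are meaningful. *)
Record chart : Type := Chart {
  cdom : set M;
  cmap : M -> 'rV[R]_m;
  cinv : 'rV[R]_m -> M;
  cdom_open : open cdom;
  cimg_open : open (cmap @` cdom);
  cmapK : forall p, cdom p -> cinv (cmap p) = p;
  cmap_continuous : forall p, cdom p -> {for p, continuous cmap};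
  cinv_continuous : forall y, (cmap @` cdom) y -> {for y, continuous cinv}
}.

Definition transition_smooth (c c' : chart) : Prop :=
  forall i : 'I_m, smooth_on (cmap c @` (cdom c `&` cdom c'))
                             (fun y => cmap c' (cinv c y) 0 i).

Definition compatible (c c' : chart) : Prop :=
  transition_smooth c c' /\ transition_smooth c' c.

(* A maximal atlas on a Hausdorff second countable space. *)
Record smooth_structure (A : set chart) : Prop := SmoothStructure {
  ss_hausdorff : hausdorff_space M;
  ss_second_countable : @second_countable M;
  ss_cover : forall p : M, exists2 c, A c & cdom c p;
  ss_compatible : forall c c', A c -> A c' -> compatible c c';
  ss_maximal : forall c, (forall c', A c' -> compatible c c') -> A c
}.

Definition smooth_in_chart (c : chart) (V : set M) (u : M -> R) : Prop :=
  smooth_on (cmap c @` (V `&` cdom c)) (u \o cinv c).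

Definition csmooth_in_chart (c : chart) (V : set M) (f : M -> R[i]) : Prop :=
  smooth_in_chart c V (fun p => complex.Re (f p)) /\
  smooth_in_chart c V (fun p => complex.Im (f p)).

(* f \in C^oo(M), complex-valued *)
Definition smooth (A : set chart) (f : M -> R[i]) : Prop :=
  forall c, A c -> csmooth_in_chart c (cdom c) f.

Definition dchart (c : chart) (i : 'I_m) (u : M -> R) : M -> R :=
  fun p => 'D_(delta_mx 0 i) (u \o cinv c) (cmap c p).

Definition cdchart (c : chart) (i : 'I_m) (f : M -> R[i]) : M -> R[i] :=
  fun p => dchart c i (fun q => complex.Re (f q)) p
           +i* dchart c i (fun q => complex.Im (f q)) p.

Definition iter_cdchart (c : chart) (s : seq 'I_m) (f : M -> R[i]) : M -> R[i] :=
  foldr (cdchart c) f s.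

(* On V, B(f,h) is a sum of terms a * D(f) * D'(h) with a smooth on V, D a
   partial derivative of order <= k and D' one of order <= l in the coordinates
   of c.  Partial derivatives are indexed by words in the coordinate indices
   rather than by multi-indices; the coefficients are thus not unique, but the
   class of operators is the same. *)
Definition bidiff_expr (A : set chart) (c : chart) (V : set M) (k l : nat)
    (B : (M -> R[i]) -> (M -> R[i]) -> M -> R[i]) : Prop :=
  exists a : seq 'I_m -> seq 'I_m -> M -> R[i],
    (forall s t, csmooth_in_chart c V (a s t)) /\
    (forall f h, smooth A f -> smooth A h -> forall p, V p ->
      B f h p =
        \sum_(i < k.+1) \sum_(s : i.-tuple 'I_m)
          \sum_(j < l.+1) \sum_(t : j.-tuple 'I_m)
            a s t p * iter_cdchart c s f p * iter_cdchart c t h p).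

Definition bidiff_order (A : set chart) (k l : nat)
    (B : (M -> R[i]) -> (M -> R[i]) -> M -> R[i]) : Prop :=
  forall c p, A c -> cdom c p ->
    exists V, [/\ open V, V p, V `<=` cdom c & bidiff_expr A c V k l B].

(* The order is only required to be locally finite. *)
Definition bidifferential (A : set chart)
    (B : (M -> R[i]) -> (M -> R[i]) -> M -> R[i]) : Prop :=
  forall c p, A c -> cdom c p ->
    exists V k l, [/\ open V, V p, V `<=` cdom c & bidiff_expr A c V k l B].

(* Entry (i,j) is the derivative of the i-th coordinate of c' along the j-th
   coordinate of c. *)
Definition jacobian (c c' : chart) (p : M) : 'M[R]_m :=
  \matrix_(i, j) dchart c j (fun q => cmap c' q 0 i) p.

(* g c p i j = g(d_i, d_j) at p, in the coordinates of c *)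
Record pseudo_riemannian (A : set chart) (g : chart -> M -> 'M[R]_m) : Prop :=
  PseudoRiemannian {
  pr_smooth : forall c, A c -> forall i j,
    smooth_in_chart c (cdom c) (fun q => g c q i j);
  pr_tensor : forall c c', A c -> A c' -> forall p, cdom c p -> cdom c' p ->
    g c p = (jacobian c c' p)^T *m g c' p *m jacobian c c' p;
  pr_sym : forall c, A c -> forall p, cdom c p -> (g c p)^T = g c p;
  pr_nondegenerate : forall c, A c -> forall p, cdom c p -> g c p \in unitmx
}.

(* S c p i j = S^i_j, that is S(d_j) = \sum_i S^i_j d_i *)
Record endomorphism_field (A : set chart) (S : chart -> M -> 'M[R]_m) : Prop :=
  EndomorphismField {
  ef_smooth : forall c, A c -> forall i j,
    smooth_in_chart c (cdom c) (fun q => S c q i j);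
  ef_tensor : forall c c', A c -> A c' -> forall p, cdom c p -> cdom c' p ->
    jacobian c c' p *m S c p = S c' p *m jacobian c c' p
}.

(* Gamma^k_{ij} of the Levi-Civita connection of g *)
Definition christoffel (g : chart -> M -> 'M[R]_m) (c : chart) (p : M)
    (k i j : 'I_m) : R :=
  2^-1 * \sum_(l < m) invmx (g c p) k l *
    (dchart c i (fun q => g c q j l) p + dchart c j (fun q => g c q i l) p
     - dchart c l (fun q => g c q i j) p).

(* nabla S = 0:
   d_k S^i_j + Gamma^i_{kl} S^l_j - Gamma^l_{kj} S^i_l = 0 *)
Definition parallel (A : set chart) (g S : chart -> M -> 'M[R]_m) : Prop :=
  forall c, A c -> forall p, cdom c p -> forall i j k,
    dchart c k (fun q => S c q i j) p
    + \sum_(l < m) christoffel g c p i k l * S c p l j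
    - \sum_(l < m) christoffel g c p l k j * S c p i l = 0.

End SmoothManifolds.

Section PseudoKaehler.
Variables (R : realType) (n : nat) (M : topologicalType).
Local Notation chart := (chart R (n + n) M).
Implicit Types (A : set chart) (g I : chart -> M -> 'M[R]_(n + n)).

(* With coordinates (x_1, .., x_n, y_1, .., y_n):
   d/dx_k |-> d/dy_k  and  d/dy_k |-> - d/dx_k. *)
Definition std_complex_structure : 'M[R]_(n + n) :=
  block_mx 0 (- 1%:M) 1%:M 0.

(* z_k = x_k + i y_k are holomorphic coordinates for I. *)
Definition holomorphic_chart I (c : chart) : Prop :=
  forall p, cdom c p -> I c p = std_complex_structure.

Record pseudo_kaehler A g I : Prop := PseudoKaehler {
  pk_metric : pseudo_riemannian A g;
  pk_field : endomorphism_field A I;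
  pk_almost_complex : forall c, A c -> forall p, cdom c p ->
    I c p *m I c p = - 1%:M;
  pk_isometry : forall c, A c -> forall p, cdom c p ->
    (I c p)^T *m g c p *m I c p = g c p;
  pk_parallel : parallel A g I;
  (* M is a complex manifold with complex structure I: it is covered by
     holomorphic charts.  This is redundant, by the Newlander-Nirenberg theorem
     (I is integrable because it is parallel for a torsion-free connection). *)
  pk_complex : forall p : M, exists c, [/\ A c, cdom c p & holomorphic_chart I c]
}.

(* omega(d_i, d_j) = g(I d_i, d_j) *)
Definition omega g I (c : chart) (p : M) : 'M[R]_(n + n) :=
  (I c p)^T *m g c p.

(* Z_k = (d/dx_k - i d/dy_k) / 2 and its conjugate, by their components. *)
Definition Zvec (k : 'I_n) : 'cV[R[i]]_(n + n) :=
  2^-1 *: (delta_mx (lshift n k) 0 - 'i%C *: delta_mx (rshift n k) 0).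

Definition Zbarvec (k : 'I_n) : 'cV[R[i]]_(n + n) :=
  2^-1 *: (delta_mx (lshift n k) 0 + 'i%C *: delta_mx (rshift n k) 0).

Definition Zder (c : chart) (k : 'I_n) (f : M -> R[i]) : M -> R[i] :=
  fun p => \sum_(j < n + n) Zvec k j 0 * cdchart c j f p.

Definition Zbarder (c : chart) (k : 'I_n) (f : M -> R[i]) : M -> R[i] :=
  fun p => \sum_(j < n + n) Zbarvec k j 0 * cdchart c j f p.

(* omega = (i/2) g_{k lbar} dz^k /\ dzbar^l, that is
   g_{k lbar} = (2/i) omega(Z_k, Zbar_l) *)
Definition gbar g I (c : chart) (p : M) : 'M[R[i]]_n :=
  \matrix_(k, l) (2 / 'i%C *
    ((Zvec k)^T *m map_mx (real_complex R) (omega g I c p) *m Zbarvec l) 0 0).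

(* g^{k lbar}, normalised by \sum_k g^{k lbar} g_{k nbar} = delta^l_n *)
Definition gbar_inv g I (c : chart) (p : M) : 'M[R[i]]_n :=
  (invmx (gbar g I c p))^T.

(* The Poisson bracket in the holomorphic chart c. *)
Definition poisson g I (c : chart) (f h : M -> R[i]) (p : M) : R[i] :=
  2 / 'i%C * \sum_(k < n) \sum_(l < n) gbar_inv g I c p k l *
    (Zder c k f p * Zbarder c l h p - Zbarder c l f p * Zder c k h p).

Definition holomorphic_on A I (U : set M) (f : M -> R[i]) : Prop :=
  forall c, A c -> holomorphic_chart I c ->
  forall p, U p -> cdom c p -> forall k, Zbarder c k f p = 0.

Definition antiholomorphic_on A I (U : set M) (f : M -> R[i]) : Prop :=
  forall c, A c -> holomorphic_chart I c ->
  forall p, U p -> cdom c p -> forall k, Zder c k f p = 0.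

(* A formal power series \sum_r nu^r F_r is the sequence of its coefficients. *)
Definition fseries := nat -> M -> R[i].

Definition fsmooth A (F : fseries) : Prop := forall r, smooth A (F r).

Definition fconst (f : M -> R[i]) : fseries :=
  fun r p => if r == 0%N then f p else 0.

Definition fadd (F G : fseries) : fseries := fun r p => F r p + G r p.

(* multiplication by an element of C[[nu]] *)
Definition fscale (a : nat -> R[i]) (F : fseries) : fseries :=
  fun r p => \sum_(i < r.+1) a i * F (r - i)%N p.

(* C_r, where f * h = \sum_r nu^r C_r(f, h) for functions f and h *)
Definition star_coef (star : fseries -> fseries -> fseries) (r : nat)
    (f h : M -> R[i]) : M -> R[i] :=
  star (fconst f) (fconst h) r.

(* A product on C^oo(M)[[nu]]: all axioms concern smooth arguments only. *)
Record star_product A g I (star : fseries -> fseries -> fseries) : Prop :=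
  StarProduct {
  star_smooth : forall F G, fsmooth A F -> fsmooth A G -> fsmooth A (star F G);
  star_linearl : forall a F F' G, fsmooth A F -> fsmooth A F' -> fsmooth A G ->
    star (fadd (fscale a F) F') G = fadd (fscale a (star F G)) (star F' G);
  star_linearr : forall a F G G', fsmooth A F -> fsmooth A G -> fsmooth A G' ->
    star F (fadd (fscale a G) G') = fadd (fscale a (star F G)) (star F G');
  star_assoc : forall F G H, fsmooth A F -> fsmooth A G -> fsmooth A H ->
    star F (star G H) = star (star F G) H;
  star_bidiff : forall r, bidifferential A (star_coef star r);
  star_coef0 : forall f h, smooth A f -> smooth A h ->
    forall p, star_coef star 0%N f h p = f p * h p;
  star_coef1 : forall f h, smooth A f -> smooth A h ->
    forall c p, A c -> holomorphic_chart I c -> cdom c p ->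
    star_coef star 1%N f h p - star_coef star 1%N h f p = poisson g I c f h p;
  star_coef_cst : forall r f (z : R[i]), (0 < r)%N -> smooth A f -> forall p,
    star_coef star r (fun=> z) f p = 0 /\ star_coef star r f (fun=> z) p = 0
}.

Definition star_is_mul_on (star : fseries -> fseries -> fseries) (U : set M)
    (f h : M -> R[i]) : Prop :=
  forall r p, U p ->
    star (fconst f) (fconst h) r p = fconst (fun q => f q * h q) r p.

Definition wick_type A I (star : fseries -> fseries -> fseries) : Prop :=
  forall (U : set M) (f g h h' : M -> R[i]), open U ->
    smooth A f -> smooth A g -> smooth A h -> smooth A h' ->
    holomorphic_on A I U h -> antiholomorphic_on A I U h' ->
    star_is_mul_on star U f h /\ star_is_mul_on star U h' g.

Definition antiwick_type A I (star : fseries -> fseries -> fseries) : Prop :=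
  forall (U : set M) (f g h h' : M -> R[i]), open U ->
    smooth A f -> smooth A g -> smooth A h -> smooth A h' ->
    holomorphic_on A I U h -> antiholomorphic_on A I U h' ->
    star_is_mul_on star U h f /\ star_is_mul_on star U g h'.

Definition vey_type A (star : fseries -> fseries -> fseries) : Prop :=
  forall r, bidiff_order A r r (star_coef star r).

End PseudoKaehler.

(* Main.v *)
Require Import Defs.
From HB Require Import structures.
From mathcomp Require Import all_boot all_order all_algebra.
From mathcomp Require Import complex.
From mathcomp Require Import all_classical all_reals all_analysis.
From mathcomp Require Import ring lra.

Set Implicit Arguments.
Unset Strict Implicit.
Unset Printing Implicit Defensive.

Import Order.TTheory GRing.Theory Num.Theory.
Import numFieldNormedType.Exports.

Local Open Scope classical_set_scope.
Local Open Scope complex_scope.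
Local Open Scope ring_scope.

(** The idea.  For functions f and h put L_r(f) = C_r(f, .) and
    Q_r(h) = C_r(., h), two operators on smooth functions, and measure operators
    by their order in the sense of Grothendieck: D has order < k if all k-fold
    commutators of D with multiplications vanish.  Associativity says that left
    multiplication by f commutes with right multiplication by h, so
    sum_s [L_(r-s)(f), Q_s(h)] = 0 for all r.  The two extreme terms are the
    commutators [L_r(f), h] and -[Q_r(h), f] with multiplications.  If the order
    of L_s and of Q_s is at most s for s < r, all other terms have order < r,
    since a commutator has order one less than the sum of the orders.  Hence
      (1)  [L_r(f), h] - [Q_r(h), f]  has order < r, for all f and h.

    Near a point choose holomorphic coordinates z_k.  For a star product of Wick
    type Q_s(z_k) = 0 and L_s(zbar_k) = 0 for s >= 1, and associativity gives
    [L_r(f), z_k] = 0 and [Q_r(h), zbar_k] = 0.  Put f = z_k and h = zbar_l in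
    (1): the operator X = [L_r(z_k), zbar_l] commutes with all z_i, the operator
    Y = [Q_r(zbar_l), z_k] commutes with all zbar_i, and X - Y has order < r.
    The order of a differential operator is detected by commutators with
    coordinates, so X and Y have order < r separately; thus L_r(z_k) and
    Q_r(zbar_l) have order at most r.  Back in (1), with h = zbar_l and arbitrary
    f, this shows that [L_r(f), zbar_l] has order < r, and L_r(f) has order at
    most r; likewise Q_r(h) ([order_lt_coefficients]).  The anti-Wick case
    exchanges z and zbar.

    Two facts connect this with coordinate expressions.  A functional
    f |-> sum_s b_s (d_s f)(p) that vanishes on all products of k coordinates
    centred at p with another function has no component of degree >= k
    ([jet_truncate]); as the indices s are words, the coefficients b_s are not
    determined, and the statement is that the components vanish as functionals.
    This detects the order by coordinates ([order_lt_coordinates]) and turns the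
    bound on the order into an expression of order (r, r) in an arbitrary chart
    ([bidiff_truncate]).  Secondly, star products only see globally smooth
    functions, so that local functions, in particular the coordinates, have to be
    extended by means of a bump function ([smooth_extension]). *)

(** * Functions of class C^k on open subsets of R^m *)

Section Calculus.
Variable R : realType.

(** The difference g - f vanishes near x, hence is differentiable at x with
    derivative 0. *)
Lemma near_eq_differentiable (V W : normedModType R) (f g : V -> W) (x : V) :
  (\forall y \near x, f y = g y) -> differentiable f x -> differentiable g x.
Proof.
move=> fg df.
suff dgf : differentiable (g - f) x.
  by rewrite -[g](subrK f); exact: differentiableD.
have fgx : (g - f) x = 0 by rewrite !fctE (nbhs_singleton fg) subrr.
apply/diff_locallyP.
have H : (g - f) \o shift x = cst ((g - f) x) + cst 0 +o_ 0 id.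
  rewrite fgx; apply/eqaddoP => e e0.
  have fg0 : \forall h \near 0, f (h + x) = g (h + x).
    by move: fg; rewrite (near_shift 0) /= subr0.
  near=> h.
  rewrite /cst /= !fctE /= addr0 subr0.
  have -> : f (h + x) = g (h + x) by near: h.
  by rewrite subrr normr0 mulr_ge0 // ltW.
have c0 : continuous (cst 0 : V -> W) by move=> ?; exact: cvg_cst.
have lin : linear (cst 0 : V -> W) by move=> a u v; rewrite /cst scaler0 addr0.
pose L := GRing.isLinear.Build R V W _ (cst 0 : V -> W) lin.
pose z : {linear V -> W} := HB.pack (cst 0 : V -> W) L.
have E : 'd (g - f) x = cst 0 :> (V -> W) by exact: (@diff_unique _ _ _ _ z).
by rewrite E; split.
Unshelve. all: by end_near. Qed.

Variable m : nat.
Implicit Types (W : set 'rV[R]_m) (u v : 'rV[R]_m -> R).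

Definition partial (i : 'I_m) u : 'rV[R]_m -> R :=
  fun y => 'D_(delta_mx 0 i) u y.

(** The recursion on k suits the product and chain rules; smooth_on W is the
    conjunction over all k ([smooth_onP]). *)
Fixpoint Ck (k : nat) W u : Prop :=
  (forall y, W y -> differentiable u y) /\
  if k is k'.+1 then forall i, Ck k' W (partial i u) else True.

Lemma Ck_diff k W u y : Ck k W u -> W y -> differentiable u y.
Proof. by case: k => [|k] []; auto. Qed.

Lemma CkW k W u : Ck k.+1 W u -> Ck k W u.
Proof.
elim: k u => [|k IH] u [du pu]; first by split.
by split=> // i; apply: IH.
Qed.

Lemma smooth_onP W u : smooth_on W u <-> forall k, Ck k W u.
Proof.
split=> [su k|H].
  elim: k u su => [|k IH] u su; (split; first by move=> y; exact: (su [::])) => //.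
  move=> i; apply: IH => s y Wy.
  suff -> : iter_partial s (partial i u) = iter_partial (rcons s i) u by exact: su.
  by rewrite /iter_partial foldr_rcons.
move=> s; elim/last_ind: s u H => [|s i IH] u H y Wy.
  exact: (Ck_diff (H 0)).
rewrite /iter_partial foldr_rcons; apply: IH => // k.
by have [_] := H k.+1; apply.
Qed.

Lemma partial_near i u v y :
  (\forall z \near y, u z = v z) -> partial i u y = partial i v y.
Proof. exact: near_eq_derive. Qed.

Lemma near_eq_on W u v y : open W -> (forall z, W z -> u z = v z) -> W y ->
  \forall z \near y, u z = v z.
Proof. by move=> oW uv Wy; near=> z; apply: uv; near: z; exact: open_nbhs_nbhs.
Unshelve. all: by end_near. Qed.

Lemma partial_on W i u v : open W -> (forall y, W y -> u y = v y) ->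
  forall y, W y -> partial i u y = partial i v y.
Proof. by move=> oW uv y Wy; apply/partial_near/(near_eq_on oW uv). Qed.

Lemma Ck_eq k W u v : open W -> (forall y, W y -> u y = v y) ->
  Ck k W u -> Ck k W v.
Proof.
move=> oW; elim: k u v => [|k IH] u v uv [du pu]; split => //.
- by move=> y Wy; apply: (near_eq_differentiable (near_eq_on oW uv Wy)); exact: du.
- by move=> y Wy; apply: (near_eq_differentiable (near_eq_on oW uv Wy)); exact: du.
- by move=> i; apply: IH (pu i); exact: partial_on.
Qed.

Lemma Ck_sub k W W' u : W' `<=` W -> Ck k W u -> Ck k W' u.
Proof.
move=> sW; elim: k u => [|k IH] u [du pu]; split=> //.
- by move=> y /sW Wy; apply: du.
- by move=> y /sW Wy; apply: du.
- by move=> i; exact: IH (pu i).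
Qed.

Lemma Ck_local k W u :
  (forall y, W y -> exists W', [/\ open W', W' y & Ck k W' u]) -> Ck k W u.
Proof.
elim: k u => [|k IH] u H; split => //.
- by move=> y /H [W' [_ W'y /Ck_diff]]; apply.
- by move=> y /H [W' [_ W'y /Ck_diff]]; apply.
- move=> i; apply: IH => y /H [W' [oW' W'y [_ /(_ i)]]].
  by exists W'.
Qed.

Lemma partial_cst i a y : partial i (cst a) y = 0.
Proof. exact: derive_cst. Qed.

Lemma Ck_cst k W (a : R) : Ck k W (cst a).
Proof.
elim: k a => [|k IH] a; split => //.
move=> i; have -> : partial i (cst a) = cst 0 by apply/funext => y; exact: partial_cst.
exact: IH.
Qed.

Lemma partialD i u v y : differentiable u y -> differentiable v y ->
  partial i (u + v) y = partial i u y + partial i v y.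
Proof. by move=> du dv; apply: deriveD; exact: diff_derivable. Qed.

Lemma partialN i u y : differentiable u y ->
  partial i (- u) y = - partial i u y.
Proof. by move=> du; apply: deriveN; exact: diff_derivable. Qed.

Lemma partialM i u v y : differentiable u y -> differentiable v y ->
  partial i (u * v) y = u y * partial i v y + v y * partial i u y.
Proof. by move=> du dv; apply: deriveM; exact: diff_derivable. Qed.

Lemma CkD k W u v : open W -> Ck k W u -> Ck k W v -> Ck k W (u + v).
Proof.
move=> oW; elim: k u v => [|k IH] u v [du pu] [dv pv].
  by split=> // y Wy; apply: differentiableD; auto.
split; first by move=> y Wy; apply: differentiableD; auto.
move=> i; apply: (@Ck_eq _ _ (partial i u + partial i v)) => //; last exact: IH (pu i) (pv i).
by move=> y Wy; rewrite partialD; auto.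
Qed.

Lemma CkN k W u : open W -> Ck k W u -> Ck k W (- u).
Proof.
move=> oW; elim: k u => [|k IH] u [du pu].
  by split=> // y Wy; apply: differentiableN; auto.
split; first by move=> y Wy; apply: differentiableN; auto.
move=> i; apply: (@Ck_eq _ _ (- partial i u)) => //; last exact: IH (pu i).
by move=> y Wy; rewrite partialN; auto.
Qed.

Lemma CkM k W u v : open W -> Ck k W u -> Ck k W v -> Ck k W (u * v).
Proof.
move=> oW; elim: k u v => [|k IH] u v [du pu] [dv pv].
  by split=> // y Wy; apply: differentiableM; auto.
split; first by move=> y Wy; apply: differentiableM; auto.
move=> i; apply: (@Ck_eq _ _ (u * partial i v + v * partial i u)) => //.
  by move=> y Wy; rewrite partialM; auto.
apply: CkD => //.
  exact: IH (CkW (conj du pu : Ck k.+1 W u)) (pv i).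
exact: IH (CkW (conj dv pv : Ck k.+1 W v)) (pu i).
Qed.

Lemma Ck_sum k W (I : Type) (r : seq I) (F : I -> 'rV[R]_m -> R) :
  open W -> (forall j, Ck k W (F j)) -> Ck k W (\sum_(j <- r) F j).
Proof.
move=> oW cF; elim: r => [|j r IH]; rewrite ?big_nil ?big_cons.
  exact: Ck_cst.
exact: CkD.
Qed.

(** The outer function of one real variable is given together with all its
    derivatives w n, and the statement is about all of them at once: the
    derivative of w n at u involves w n.+1 at u. *)
Lemma Ck_comp1 k W u (D : set R) (w : nat -> R -> R) :
  open W -> (forall n x, D x -> is_derive x 1 (w n) (w n.+1 x)) ->
  (forall y, W y -> D (u y)) -> Ck k W u -> forall n, Ck k W (w n \o u).
Proof.
move=> oW dw Du; elim: k => [|k IH] cu n.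
  split=> // y Wy; apply: differentiable_comp; first exact: Ck_diff cu Wy.
  by apply/derivable1_diffP; have := dw n _ (Du _ Wy) => ?.
have dwu y : W y -> differentiable (w n \o u) y.
  move=> Wy; apply: differentiable_comp; first exact: Ck_diff cu Wy.
  by apply/derivable1_diffP; have := dw n _ (Du _ Wy) => ?.
split=> // i.
apply: (@Ck_eq _ _ ((w n.+1 \o u) * partial i u)) => //.
  move=> y Wy; have dy := Ck_diff cu Wy.
  have dd := dw n _ (Du _ Wy).
  have dwy : differentiable (w n) (u y) by apply/derivable1_diffP.
  rewrite /partial (deriveE _ (dwu y Wy)) (diff_comp dy dwy) /=.
  rewrite -(deriveE _ dy) -[X in 'd (w n) _ X]mulr1; set d := 'D__ u y.
  have -> : 'd (w n) (u y) (d * 1) = ('d (w n) (u y) 1 : R) * (d : R).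
    by rewrite [RHS]mulrC; exact: linearZ.
  rewrite -(deriveE _ dwy).
  by rewrite derive_val.
apply: CkM => //; last exact: (proj2 cu i).
by apply: IH; exact: CkW.
Qed.

End Calculus.

Lemma diff_coord (R : realType) (m : nat) (y : 'rV[R]_m) (j : 'I_m) :
  'd (fun z : 'rV[R]_m => z 0 j) y = (fun z => z 0 j) :> ('rV[R]_m -> R).
Proof.
have lin : linear (fun z : 'rV[R]_m => z 0 j) by move=> a u v; rewrite !mxE.
pose L := GRing.isLinear.Build R _ _ _ (fun z : 'rV[R]_m => z 0 j) lin.
pose f : {linear 'rV[R]_m -> R} := HB.pack (fun z : 'rV[R]_m => z 0 j) L.
by apply: (@diff_lin _ _ _ f); exact: coord_continuous.
Qed.

Section Composition.
Variables (R : realType) (m m' : nat).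

Lemma differentiable_row (phi : 'rV[R]_m -> 'rV[R]_m') (y : 'rV[R]_m) :
  (forall j, differentiable (fun z => phi z 0 j) y) ->
  differentiable phi y /\
  forall e, 'd phi y e = \row_j 'd (fun z => phi z 0 j) y e.
Proof.
move=> dphi.
have E : phi = \sum_j (fun z => phi z 0 j *: (delta_mx 0 j : 'rV[R]_m')).
  by apply/funext => z; rewrite fct_sumE [LHS]row_sum_delta.
have D : forall j, differentiable (fun z => phi z 0 j *: (delta_mx 0 j : 'rV[R]_m')) y.
  by move=> j; apply: differentiableZl.
have dp : differentiable phi y by rewrite E; exact: differentiable_sum.
split=> // e; apply/rowP => j; rewrite mxE.
have cj : differentiable (fun M : 'rV[R]_m' => M 0 j) (phi y) by exact: differentiable_coord.
have dc : 'd ((fun z : 'rV[R]_m' => z 0 j) \o phi) y =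
    'd (fun z : 'rV[R]_m' => z 0 j) (phi y) \o 'd phi y :> (_ -> _).
  exact: diff_comp.
by rewrite (congr1 (@^~ e) dc) /= (congr1 (@^~ ('d phi y e)) (diff_coord _ _)).
Qed.

Lemma Ck_comp k (W : set 'rV[R]_m) (W' : set 'rV[R]_m') v
    (phi : 'rV[R]_m -> 'rV[R]_m') :
  open W -> (forall y, W y -> W' (phi y)) ->
  (forall j, Ck k W (fun z => phi z 0 j)) -> Ck k W' v -> Ck k W (v \o phi).
Proof.
move=> oW WW'; elim: k v => [|k IH] v cphi cv.
  split=> // y Wy; apply: differentiable_comp; last exact: Ck_diff cv (WW' _ Wy).
  by apply: (proj1 (differentiable_row _)) => j; exact: Ck_diff (cphi j) Wy.
have dphi y : W y -> differentiable phi y.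
  by move=> Wy; apply: (proj1 (differentiable_row _)) => j; exact: Ck_diff (cphi j) Wy.
have dv y : W y -> differentiable v (phi y) by move=> Wy; exact: Ck_diff cv (WW' _ Wy).
split=> [y Wy|i]; first by apply: differentiable_comp; auto.
apply: (@Ck_eq _ _ _ _ (\sum_j ((partial j v \o phi) * partial i (fun z => phi z 0 j)))) => //.
  move=> y Wy; rewrite fct_sumE /partial.
  rewrite (deriveE _ (differentiable_comp (dphi y Wy) (dv y Wy))).
  rewrite (diff_comp (dphi y Wy) (dv y Wy)) /=.
  have dj j := Ck_diff (cphi j) Wy.
  rewrite (proj2 (differentiable_row dj)).
  rewrite [X in 'd v _ X]row_sum_delta linear_sum; apply: eq_bigr => j _.
  rewrite linearZ /= mxE -(deriveE _ (dj j)) -(deriveE _ (dv y Wy)).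
  exact: mulrC.
apply: Ck_sum => // j; apply: CkM => //; last exact: (proj2 (cphi j) i).
apply: IH; last exact: (proj2 cv j).
by move=> l; exact: CkW.
Qed.

End Composition.

(** * Symmetry of second derivatives *)

Section Schwarz.
Variables (R : realType) (m : nat).
Implicit Types (W : set 'rV[R]_m) (u v : 'rV[R]_m -> R).

Lemma is_derive_line (u : 'rV[R]_m -> R) (y e : 'rV[R]_m) (s : R) :
  differentiable u (y + s *: e) ->
  is_derive s 1 (fun t => u (y + t *: e)) ('D_e u (y + s *: e)).
Proof.
move=> /diff_derivable - /(_ e).
have E : (fun h : R => h^-1 *: ((u \o shift (y + s *: e)) (h *: e) - u (y + s *: e)))
  = (fun h : R => h^-1 *: (((fun t => u (y + t *: e)) \o shift s) (h *: (1:R)) - u (y + s *: e))).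
  apply/funext => h; rewrite /= -/(h%:A) [h%:A]mulr1 scalerDl.
  by rewrite addrCA.
by rewrite /derivable E => c; split=> //; rewrite /derive E.
Qed.

Lemma mean_value_partial u (y : 'rV[R]_m) i (t : R) : 0 < t ->
  (forall s, 0 <= s <= t -> differentiable u (y + s *: delta_mx 0 i)) ->
  exists2 s, 0 <= s <= t &
    u (y + t *: delta_mx 0 i) - u y = t * partial i u (y + s *: delta_mx 0 i).
Proof.
move=> t0 du.
pose f := fun t : R => u (y + t *: delta_mx 0 i).
have D s : s \in `[0, t]%R -> is_derive s 1 f
    (partial i u (y + s *: delta_mx 0 i)).
  by rewrite in_itv /= => st; apply: is_derive_line; exact: du.
have der s : s \in `]0, t[%R -> is_derive s 1 f (partial i u (y + s *: delta_mx 0 i)).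
  by move=> st; apply: D; exact: subset_itv_oo_cc st.
have cf : {within `[0, t], continuous f}.
  by apply: derivable_within_continuous => s /D ds; exact: ex_derive.
have [s] := MVT t0 der cf.
rewrite in_itv /= => /andP[s0 st] E; exists s; first by rewrite !ltW.
by move: E; rewrite /f scale0r addr0 subr0 mulrC.
Qed.

(** The mean value theorem, applied first along i to the difference of u along j,
    then along j to the i-th partial derivative. *)
Lemma second_difference u W (x : 'rV[R]_m) i j (r t : R) : 0 < t -> t + t < r ->
  Ck 2 W u -> ball x r `<=` W ->
  exists2 z, ball x r z &
    u (x + t *: delta_mx 0 i + t *: delta_mx 0 j) - u (x + t *: delta_mx 0 i)
    - (u (x + t *: delta_mx 0 j) - u x) = t * (t * partial j (partial i u) z).
Proof.
move=> t0 tr cu bW.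
have nd (k : 'I_m) : `|delta_mx 0 k : 'rV[R]_m| <= 1.
  rewrite /Num.Def.normr /= mx_normrE (bigmax_le _ ler01) //= => p _.
  by rewrite mxE normr_nat lern1 leq_b1.
have inb a b : 0 <= a <= t -> 0 <= b <= t ->
    ball x r (x + a *: delta_mx 0 i + b *: delta_mx 0 j).
  move=> /andP[a0 at_] /andP[b0 bt].
  rewrite -ball_normE /= -addrA opprD addNKr normrN.
  apply: le_lt_trans tr; apply: le_trans (ler_normD _ _) _.
  rewrite !normrZ !ger0_norm //.
  by apply: lerD; [apply: le_trans at_|apply: le_trans bt]; rewrite ler_piMr.
pose g := fun y => u (y + t *: delta_mx 0 j) - u y.
have t0' : 0 <= (0 : R) <= t by apply/andP; split; [exact: lexx|exact: ltW].
have tt : 0 <= t <= t by apply/andP; split; [exact: ltW|exact: lexx].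
pose f := fun s : R => g (x + s *: delta_mx 0 i).
have D1 : forall a, 0 <= a <= t ->
   is_derive a 1 f
   (partial i u (x + a *: delta_mx 0 i + t *: delta_mx 0 j)
     - partial i u (x + a *: delta_mx 0 i)).
  move=> a ha; rewrite /f /g.
  have -> : (fun s => u (x + s *: delta_mx 0 i + t *: delta_mx 0 j) - u (x + s *: delta_mx 0 i)) =
    (fun s => u ((x + t *: delta_mx 0 j) + s *: delta_mx 0 i)) - (fun s => u (x + s *: delta_mx 0 i)).
    by apply/funext => s; rewrite !fctE addrAC.
  rewrite [x + a *: _ + _]addrAC.
  apply: is_deriveB; apply: is_derive_line.
    by apply: (Ck_diff cu); apply: bW; rewrite addrAC; exact: inb.
  by apply: (Ck_diff cu); apply: bW; have := inb a 0 ha t0'; rewrite scale0r addr0.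
have der s : s \in `]0, t[%R -> is_derive s 1 f
    (partial i u (x + s *: delta_mx 0 i + t *: delta_mx 0 j)
     - partial i u (x + s *: delta_mx 0 i)).
  by move=> /subset_itv_oo_cc; rewrite in_itv /= => st; exact: D1.
have cf : {within `[0, t], continuous f}.
  apply: derivable_within_continuous => s; rewrite in_itv /= => /D1 ds.
  exact: ex_derive.
have [a] := MVT t0 der cf.
rewrite in_itv /= => /andP[a0 at_]; rewrite /f /g scale0r addr0 subr0 => ->.
have ha : 0 <= a <= t by rewrite !ltW.
have dpi b : 0 <= b <= t ->
    differentiable (partial i u) (x + a *: delta_mx 0 i + b *: delta_mx 0 j).
  move=> hb; have cu1 : Ck 1 W (partial i u) := proj2 cu i.
  by apply: (Ck_diff cu1); apply: bW; exact: inb.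
have [b hb ->] := mean_value_partial t0 dpi.
exists (x + a *: delta_mx 0 i + b *: delta_mx 0 j); first exact: inb.
by rewrite mulrC.
Qed.

(** By [second_difference] the same second difference of u is, up to the factor
    t ^ 2, a value near y of either mixed derivative; both are continuous at y. *)
Lemma partialC W u i j y : open W -> Ck 2 W u -> W y ->
  partial i (partial j u) y = partial j (partial i u) y.
Proof.
move=> oW cu Wy.
have ct (k l : 'I_m) : {for y, continuous (partial k (partial l u))}.
  apply: differentiable_continuous.
  have cu0 : Ck 0 W (partial k (partial l u)) := proj2 (proj2 cu l) k.
  exact: Ck_diff cu0 Wy.
have nW : nbhs y W by apply: open_nbhs_nbhs; split.
apply/eqP; rewrite -subr_eq0 -normr_le0; apply/ler_addgt0Pl => e e0.
rewrite addr0.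
have e2 : 0 < e / 2 by rewrite divr_gt0.
have cl (k l : 'I_m) := (@cvgrPdist_lt _ _ _ _ _ _ _).1 (ct k l) _ e2.
have [r /= r0 H] := (nbhs_ballP _ _).1 (filterI (cl _ i j) (filterI (cl _ j i) nW)).
have [||||z yz Ez] := @second_difference u W y i j r (r / 3) => //.
- by rewrite divr_gt0.
- by rewrite -mulrDl ltr_pdivrMr // mulrC; lra.
- by move=> z /H [_ []].
have [||||z' yz' Ez'] := @second_difference u W y j i r (r / 3) => //.
- by rewrite divr_gt0.
- by rewrite -mulrDl ltr_pdivrMr // mulrC; lra.
- by move=> z0 /H [_ []].
have E : partial j (partial i u) z = partial i (partial j u) z'.
  have r3 : r / 3 != 0 by rewrite mulf_neq0 // ?gt_eqF // invr_gt0.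
  apply: (mulfI r3); apply: (mulfI r3); rewrite -Ez -Ez' [y + _ + _]addrAC.
  by rewrite !opprB; ring.
move: E (H _ yz) (H _ yz') => + [_ [+ _]] [+ _]; rewrite /=.
move: (partial j (partial i u)) (partial i (partial j u)) => f g E H1 H2.
apply: le_trans (ler_distD (g z') _ _) _.
rewrite (splitr e) -{2}E [X in _ + X]distrC; apply: lerD; exact: ltW.
Qed.

End Schwarz.

(** * Bump functions *)

Section FlatFunction.
Variable R : realType.
Implicit Types (p : {poly R}) (x s : R).

(** The function p(1/x) exp(-1/x), extended by 0 to x <= 0.  This family contains
    the standard flat function (p = 1) and is closed under derivation, which
    makes smoothness at 0 a statement about first derivatives only. *)
Definition flat p x : R := if 0 < x then p.[x^-1] * expR (- x^-1) else 0.

(** Since (p(1/x) exp(-1/x))' = (p(1/x) - p'(1/x)) / x ^ 2 * exp(-1/x). *)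
Definition flat_next p : {poly R} := 'X^2 * (p - p^`()).

(** In terms of s = 1/x this bounds the flat functions by C x ^ 2; it follows
    coefficientwise from s ^ n / n! <= exp s. *)
Lemma poly_expR_bound p :
  exists2 C : R, 0 <= C & forall s, 0 < s -> `|p.[s] * expR (- s)| * s ^+ 2 <= C.
Proof.
exists (\sum_(i < size p) `|p`_i| * (i.+2)`!%:R).
  by apply: sumr_ge0 => i _; rewrite mulr_ge0.
move=> s s0; rewrite normrM (ger0_norm (expR_ge0 _)) horner_coef.
apply: (@le_trans _ _ ((\sum_(i < size p) `|p`_i| * s ^+ i) * expR (- s) * s ^+ 2)).
  apply: ler_wpM2r; first exact: sqr_ge0.
  apply: ler_wpM2r; first exact: expR_ge0.
  apply: le_trans (ler_norm_sum _ _ _) _.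
  by apply: ler_sum => i _; rewrite normrM [`|s ^+ _|]ger0_norm // exprn_ge0 // ltW.
rewrite -mulrA mulr_suml; apply: ler_sum => i _.
rewrite -mulrA; apply: ler_wpM2l => //.
rewrite [expR _ * _]mulrC mulrA -exprD addn2 expRN ler_pdivrMr ?expR_gt0 //.
(* exp s >= 1 + s ^ (i+2) / (i+2)! *)
have := expR_ge1Dxn i.+1 (ltW s0).
move=> H; have {}H : s ^+ i.+2 / (i.+2)`!%:R <= expR s by lra.
rewrite ler_pdivrMr ?ltr0n ?fact_gt0 // in H.
by rewrite mulrC.
Qed.

Lemma is_derive_flat_gt0 p x : 0 < x ->
  is_derive x 1 (flat p) (flat (flat_next p) x).
Proof.
move=> x0; have xn0 : x != 0 by rewrite gt_eqF.
have dV : is_derive x 1 (fun y : R => y^-1) (- x ^- 2).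
  apply: is_derive_eq; first exact: (is_deriveV xn0 (is_derive_id x 1)).
  by rewrite /GRing.scale /= mulr1.
have dN : is_derive x 1 (fun y : R => - y^-1) (x ^- 2).
  by apply: is_derive_eq; rewrite opprK.
have dE : is_derive x 1 (expR \o (fun y : R => - y^-1)) (expR (- x^-1) * x ^- 2).
  exact: is_derive1_comp.
have dP : is_derive x 1 (horner p \o (fun y : R => y^-1)) (p^`().[x^-1] * - x ^- 2).
  exact: is_derive1_comp.
have dM := is_deriveM dP dE.
rewrite /flat x0.
apply: (@near_eq_is_derive _ _ _
  ((horner p \o (fun y : R => y^-1)) * (expR \o (fun y : R => - y^-1)))).
  near=> y; rewrite fctE /=; have -> // : 0 < y.
  by near: y; exact: lt_nbhsr.
apply: is_derive_eq.
rewrite /flat_next hornerM hornerXn hornerD hornerN /GRing.scale /= exprVn; ring.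
Unshelve. all: by end_near. Qed.

Lemma is_derive_flat_lt0 p x : x < 0 ->
  is_derive x 1 (flat p) (flat (flat_next p) x).
Proof.
move=> x0; rewrite {2}/flat ltNge ltW //=.
apply: (@near_eq_is_derive _ _ _ (cst 0)).
  near=> y; rewrite /flat /cst ltNge ltW //.
  by near: y; exact: lt_nbhsl.
Unshelve. all: by end_near. Qed.

(** The difference quotient at 0 is bounded by C h, by [poly_expR_bound]. *)
Lemma is_derive_flat_0 p : is_derive (0 : R) 1 (flat p) (flat (flat_next p) 0).
Proof.
rewrite {2}/flat ltxx.
have [C C0 HC] := poly_expR_bound p.
have cv : (fun h : R => h^-1 *: ((flat p \o shift 0) (h *: (1 : R)) - flat p 0)) @ 0^' --> (0 : R).
  apply/cvgrPdist_lt => e e0.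
  near=> h.
  rewrite /= -/(h%:A) [h%:A]mulr1 addr0 {2}/flat ltxx subr0 sub0r normrN.
  have hn0 : h != 0 by near: h; exact: nbhs_dnbhs_neq.
  rewrite /flat; case: ifPn => h0; last by rewrite scaler0 normr0.
  have := HC h^-1; rewrite invr_gt0 => /(_ h0) H.
  rewrite /GRing.scale /= normrM (ger0_norm (ltW (_ : 0 < h^-1))) ?invr_gt0 //.
  apply: (@le_lt_trans _ _ (C * h)).
    rewrite -ler_pdivrMr //; apply: le_trans H.
    by rewrite mulrAC expr2 mulrC mulrA.
  have hC : h < e / (C + 1).
    apply: le_lt_trans (ler_norm _) _.
    near: h; apply: dnbhs0_lt; rewrite divr_gt0 //; lra.
  apply: (@le_lt_trans _ _ ((C + 1) * h)); first by rewrite ler_pM2r //; lra.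
  by rewrite mulrC -ltr_pdivlMr //; lra.
split; first by apply/cvg_ex; exists 0.
exact: cvg_lim cv.
Unshelve. all: by end_near. Qed.

Lemma is_derive_flat p x : is_derive x 1 (flat p) (flat (flat_next p) x).
Proof.
have [x0|x0|->] := ltgtP x 0.
- exact: is_derive_flat_lt0.
- exact: is_derive_flat_gt0.
- exact: is_derive_flat_0.
Qed.

End FlatFunction.

Section Bump.
Variables (R : realType) (m : nat).
Implicit Types (W : set 'rV[R]_m) (u v q : 'rV[R]_m -> R).

Definition flat1 : R -> R := flat 1.

Lemma flat1_gt0 x : (0 < flat1 x) = (0 < x).
Proof.
rewrite /flat1 /flat; case: ifP => _; last by rewrite ltxx.
by rewrite hornerC mul1r expR_gt0.
Qed.

Lemma flat1_ge0 x : 0 <= flat1 x.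
Proof. by rewrite /flat1 /flat; case: ifP => // _; rewrite hornerC mul1r expR_ge0. Qed.

Lemma flat1_eq0 x : x <= 0 -> flat1 x = 0.
Proof. by rewrite /flat1 /flat leNgt => /negbTE ->. Qed.

Lemma Ck_flat1 k W u : open W -> Ck k W u -> Ck k W (flat1 \o u).
Proof.
move=> oW cu.
apply: (@Ck_comp1 _ _ k W u setT (fun n => flat (iter n (@flat_next R) 1)) _ _ _ _ 0) => //.
by move=> n x _; exact: is_derive_flat.
Qed.

Lemma CkV k W u : open W -> (forall y, W y -> u y != 0) -> Ck k W u ->
  Ck k W (fun y => (u y)^-1).
Proof.
move=> oW u0; elim: k => [|k IH] cu.
  split=> // y Wy; apply: differentiableV; first exact: Ck_diff cu Wy.
  exact: u0.
have [du pu] := cu.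
split; first by move=> y Wy; apply: differentiableV; [exact: du|exact: u0].
move=> i.
apply: (@Ck_eq _ _ _ _
  (- (partial i u) * ((fun y => (u y)^-1) * (fun y => (u y)^-1)))) => //.
  move=> y Wy; rewrite [RHS]/partial deriveV ?u0 //; last first.
    by apply: diff_derivable; exact: du.
  rewrite -[LHS]/(- partial i u y * ((u y)^-1 * (u y)^-1)).
  rewrite -[RHS]/(- (u y ^- 2) * partial i u y).
  by rewrite !mulNr mulrC expr2 invfM.
have cV := IH (CkW cu).
by apply: CkM => //; [apply: CkN => //; exact: pu|apply: CkM].
Qed.

Lemma partial_coord i j (y : 'rV[R]_m) :
  partial j (fun y : 'rV[R]_m => y 0 i) y = (i == j)%:R.
Proof.
have dc : differentiable (fun y : 'rV[R]_m => y 0 i) y by exact: differentiable_coord.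
by rewrite /partial (deriveE _ dc) (congr1 (@^~ (delta_mx 0 j)) (diff_coord _ _)) /= mxE eqxx.
Qed.

Lemma Ck_coord k W i : Ck k W (fun y : 'rV[R]_m => y 0 i).
Proof.
case: k => [|k]; split=> //; try (by move=> y _; exact: differentiable_coord).
move=> j; suff -> : partial j (fun y : 'rV[R]_m => y 0 i) = cst (i == j)%:R.
  exact: Ck_cst.
by apply/funext => y; exact: partial_coord.
Qed.

(** With q the square of the Euclidean distance to x, the quotient a / (a + b) is
    0 for q >= r ^ 2 and 1 for q <= r ^ 2 / 2, where a is flat in r ^ 2 - q and b
    in q - r ^ 2 / 2.  The norm in the last clause is the maximum norm, which is
    smaller than the Euclidean one. *)
Lemma bump_function (x : 'rV[R]_m) (r : R) : 0 < r ->
  exists chi : 'rV[R]_m -> R, [/\ forall k, Ck k setT chi,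
    (\forall y \near x, chi y = 1) &
    forall y, r < `|y - x| -> chi y = 0].
Proof.
move=> r0.
pose q := \sum_(i < m) (fun y : 'rV[R]_m => y 0 i - x 0 i) * (fun y => y 0 i - x 0 i).
have qE y : q y = \sum_(i < m) (y 0 i - x 0 i) ^+ 2.
  by rewrite /q fct_sumE; apply: eq_bigr => i _; rewrite fctE expr2.
have cq k : Ck k setT q.
  have oT := @openT 'rV[R]_m.
  by apply: Ck_sum => // i; apply: CkM => //;
    apply: (CkD (v := cst (- x 0 i))) => //; [exact: Ck_coord|exact: Ck_cst|exact: Ck_coord|exact: Ck_cst].
pose a y := flat1 (r ^+ 2 - q y).
pose b y := flat1 (q y - r ^+ 2 / 2).
have oT := @openT 'rV[R]_m.
have ca k : Ck k setT a.
  apply: Ck_flat1 => //; apply: (CkD (u := cst (r ^+ 2)) (v := - q)) => //; first exact: Ck_cst.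
  exact: CkN.
have cb k : Ck k setT b.
  by apply: Ck_flat1 => //; apply: (CkD (u := q) (v := cst (- (r ^+ 2 / 2)))) => //; exact: Ck_cst.
have ab0 y : 0 < a y + b y.
  have [h|h] := ltP (q y) (r ^+ 2).
    by apply: ltr_wpDr; [exact: flat1_ge0|rewrite flat1_gt0 subr_gt0].
  apply: ltr_wpDl; [exact: flat1_ge0|rewrite flat1_gt0 subr_gt0].
  apply: lt_le_trans h; have : 0 < r ^+ 2 by rewrite exprn_gt0.
  lra.
exists (a * (fun y => (a y + b y)^-1)); split.
- move=> k; apply: CkM => //; apply: CkV => //; first by move=> y _; rewrite gt_eqF.
  exact: (CkD (u := a) (v := b)).
- have cqx : {for x, continuous q}.
    by apply: differentiable_continuous; apply: (Ck_diff (cq 0%N)).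
  have qx : q x = 0.
    by rewrite qE big1 // => i _; rewrite subrr expr0n.
  have r2 : 0 < r ^+ 2 / 2 by rewrite divr_gt0 // exprn_gt0.
  have nq : \forall y \near x, `|q x - q y| < r ^+ 2 / 2.
    exact: (@cvgrPdist_lt _ _ _ _ _ _ _).1 cqx _ r2.
  apply: filterS nq => y /=; rewrite qx sub0r normrN => qy.
  have b0 : b y = 0.
    rewrite /b; apply: flat1_eq0; rewrite subr_le0; apply: ltW; apply: le_lt_trans qy; exact: ler_norm.
  rewrite fctE b0 addr0 mulfV //.
  by have := ab0 y; rewrite b0 addr0 => /gt_eqF ->.
- move=> y ry; rewrite fctE; suff -> : a y = 0 by rewrite mul0r.
  rewrite /a; apply: flat1_eq0; rewrite subr_le0.
  have yx0 : `|y - x| != 0 by rewrite gt_eqF // (lt_trans r0).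
  have [[i j] /= Ei] := mx_norm_neq0 yx0.
  have {}Ei : `|y - x| = `|y 0 j - x 0 j|.
    by rewrite /Num.Def.normr /= Ei !mxE (ord1 i).
  rewrite qE (bigD1 j) //=.
  apply: (@le_trans _ _ ((y 0 j - x 0 j) ^+ 2)).
    rewrite -[leRHS]ger0_norm ?sqr_ge0 // normrX -Ei.
    by rewrite lerXn2r ?nnegrE // ltW.
  by rewrite lerDl; apply: sumr_ge0 => k _; exact: sqr_ge0.
Qed.

End Bump.

(** * Derivatives in a chart *)

Section ChartCalculus.
Variables (R : realType) (m : nat) (M : topologicalType).
Implicit Types (c : chart R m M) (u v : M -> R).

Definition cimg c : set 'rV[R]_m := cmap c @` cdom c.

Lemma cimg_cmap c p : cdom c p -> cimg c (cmap c p).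
Proof. by exists p. Qed.

Lemma cinvK c y : cimg c y -> cmap c (cinv c y) = y.
Proof. by move=> [q cq <-]; rewrite cmapK. Qed.

Lemma cinv_dom c y : cimg c y -> cdom c (cinv c y).
Proof. by move=> [q cq <-]; rewrite cmapK. Qed.

Lemma near_cinv c p (P : set M) : cdom c p -> (\forall q \near p, P q) ->
  \forall y \near cmap c p, P (cinv c y).
Proof.
move=> cp nP; have := cinv_continuous (cimg_cmap cp).
by move=> /(_ P); rewrite /= cmapK //; apply.
Qed.

Lemma near_cmap c p (P : set 'rV[R]_m) : cdom c p ->
  (\forall y \near cmap c p, P y) -> \forall q \near p, P (cmap c q).
Proof. by move=> cp nP; have := cmap_continuous cp; move=> /(_ P); apply. Qed.

Lemma near_cimg c p : cdom c p -> \forall y \near cmap c p, cimg c y.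
Proof.
by move=> cp; apply: open_nbhs_nbhs; split; [exact: cimg_open|exact: cimg_cmap].
Qed.

Lemma open_chart_image c (V : set M) : open V -> open (cmap c @` (V `&` cdom c)).
Proof.
move=> oV; rewrite openE => _ [q [Vq cq] <-] /=; rewrite /interior.
have nV : \forall z \near q, (V `&` cdom c) z.
  by apply: open_nbhs_nbhs; split => //; apply: openI => //; exact: cdom_open.
apply: filterS (filterI (near_cimg cq) (near_cinv cq nV)) => y [Wy /= Vy].
by exists (cinv c y) => //; rewrite cinvK.
Qed.

Definition chart_smooth c u := forall k, Ck k (cimg c) (u \o cinv c).

Lemma chart_smoothP c u : smooth_in_chart c (cdom c) u <-> chart_smooth c u.
Proof.
rewrite /smooth_in_chart setIid; exact: smooth_onP.
Qed.

Lemma chart_smooth_cst c (a : R) : chart_smooth c (cst a).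
Proof. by move=> k; exact: Ck_cst. Qed.

Lemma chart_smoothD c u v : chart_smooth c u -> chart_smooth c v -> chart_smooth c (u + v).
Proof. by move=> su sv k; apply: (CkD _ (su k) (sv k)); exact: cimg_open. Qed.

Lemma chart_smoothN c u : chart_smooth c u -> chart_smooth c (- u).
Proof. by move=> su k; apply: (CkN _ (su k)); exact: cimg_open. Qed.

Lemma chart_smoothM c u v : chart_smooth c u -> chart_smooth c v -> chart_smooth c (u * v).
Proof. by move=> su sv k; apply: (CkM _ (su k) (sv k)); exact: cimg_open. Qed.

Lemma dchart_cinv c i u y : cimg c y ->
  dchart c i u (cinv c y) = partial i (u \o cinv c) y.
Proof. by move=> Wy; rewrite /dchart cinvK. Qed.

Lemma chart_smooth_dchart c i u : chart_smooth c u -> chart_smooth c (dchart c i u).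
Proof.
move=> su k; apply: (@Ck_eq _ _ _ _ (partial i (u \o cinv c))); first exact: cimg_open.
  by move=> y Wy; rewrite /= dchart_cinv.
exact: (proj2 (su k.+1) i).
Qed.

Lemma chart_smooth_coord c i : chart_smooth c (fun q => cmap c q 0 i).
Proof.
move=> k; apply: (@Ck_eq _ _ _ _ (fun y => y 0 i)); first exact: cimg_open.
  by move=> y Wy; rewrite /= cinvK.
exact: Ck_coord.
Qed.

Lemma chart_smooth_diff c u p : chart_smooth c u -> cdom c p ->
  differentiable (u \o cinv c) (cmap c p).
Proof. by move=> su cp; apply: (Ck_diff (su 0%N)); exact: cimg_cmap. Qed.

Lemma dchart_cst c i (a : R) p : dchart c i (cst a) p = 0.
Proof. exact: derive_cst. Qed.

Lemma dchartD c i u v p : chart_smooth c u -> chart_smooth c v -> cdom c p ->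
  dchart c i (u + v) p = dchart c i u p + dchart c i v p.
Proof. by move=> su sv cp; apply: partialD; exact: chart_smooth_diff. Qed.

Lemma dchartN c i u p : chart_smooth c u -> cdom c p -> dchart c i (- u) p = - dchart c i u p.
Proof. by move=> su cp; apply: partialN; exact: chart_smooth_diff. Qed.

Lemma dchartM c i u v p : chart_smooth c u -> chart_smooth c v -> cdom c p ->
  dchart c i (u * v) p = dchart c i u p * v p + u p * dchart c i v p.
Proof.
move=> su sv cp; rewrite /dchart.
have := partialM i (chart_smooth_diff su cp) (chart_smooth_diff sv cp).
rewrite /= cmapK // => E; rewrite -[LHS]/(partial i ((u \o cinv c) * (v \o cinv c)) (cmap c p)) E.
by rewrite addrC [v p * _]mulrC.
Qed.

Lemma dchart_near c i u v p : cdom c p -> (\forall q \near p, u q = v q) ->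
  dchart c i u p = dchart c i v p.
Proof.
by move=> cp uv; apply: partial_near; exact: (near_cinv cp uv).
Qed.

Lemma dchartC c i j u p : chart_smooth c u -> cdom c p ->
  dchart c i (dchart c j u) p = dchart c j (dchart c i u) p.
Proof.
move=> su cp.
have E k l : dchart c k (dchart c l u) p = partial k (partial l (u \o cinv c)) (cmap c p).
  apply: partial_near; apply: filterS (near_cimg cp) => y Wy.
  by rewrite /= dchart_cinv.
rewrite !E; apply: (partialC i j _ (su 2%N)); [exact: cimg_open|exact: cimg_cmap].
Qed.

Lemma dchart_coord c i j p : cdom c p ->
  dchart c j (fun q => cmap c q 0 i) p = (i == j)%:R.
Proof.
move=> cp; rewrite -(partial_coord i j (cmap c p)); apply: partial_near.
by apply: filterS (near_cimg cp) => y Wy; rewrite /= cinvK.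
Qed.

End ChartCalculus.

Section ComplexChartCalculus.
Variables (R : realType) (m : nat) (M : topologicalType).
Implicit Types (c : chart R m M) (f g : M -> R[i]).

Definition fRe f : M -> R := fun q => complex.Re (f q).
Definition fIm f : M -> R := fun q => complex.Im (f q).

Definition cchart_smooth c f := chart_smooth c (fRe f) /\ chart_smooth c (fIm f).

Lemma cchart_smoothP c f : csmooth_in_chart c (cdom c) f <-> cchart_smooth c f.
Proof. by rewrite /csmooth_in_chart !chart_smoothP. Qed.

Lemma fReD f g : fRe (f + g) = fRe f + fRe g.
Proof. by apply/funext => q; rewrite /fRe !fctE; case: (f q); case: (g q). Qed.
Lemma fImD f g : fIm (f + g) = fIm f + fIm g.
Proof. by apply/funext => q; rewrite /fIm !fctE; case: (f q); case: (g q). Qed.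
Lemma fReM f g : fRe (f * g) = fRe f * fRe g - fIm f * fIm g.
Proof. by apply/funext => q; rewrite /fRe /fIm !fctE; case: (f q); case: (g q). Qed.
Lemma fImM f g : fIm (f * g) = fRe f * fIm g + fIm f * fRe g.
Proof. by apply/funext => q; rewrite /fRe /fIm !fctE; case: (f q); case: (g q). Qed.

Lemma cchart_smoothD c f g : cchart_smooth c f -> cchart_smooth c g -> cchart_smooth c (f + g).
Proof. by move=> [? ?] [? ?]; split; rewrite ?fReD ?fImD; exact: chart_smoothD. Qed.

Lemma cchart_smoothM c f g : cchart_smooth c f -> cchart_smooth c g -> cchart_smooth c (f * g).
Proof.
move=> [? ?] [? ?]; split; rewrite ?fReM ?fImM.
  by apply: chart_smoothD; [exact: chart_smoothM|apply: chart_smoothN; exact: chart_smoothM].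
by apply: chart_smoothD; exact: chart_smoothM.
Qed.

Lemma cchart_smooth_cst c (z : R[i]) : cchart_smooth c (cst z).
Proof. by split; exact: chart_smooth_cst. Qed.

Lemma cchart_smooth_cdchart c i f : cchart_smooth c f -> cchart_smooth c (cdchart c i f).
Proof. by move=> [? ?]; split; apply: chart_smooth_dchart. Qed.

Lemma cchart_smooth_coord c i : cchart_smooth c (fun q => (cmap c q 0 i)%:C).
Proof. by split; [exact: chart_smooth_coord|exact: chart_smooth_cst]. Qed.

Lemma cdchart_cst c i (z : R[i]) p : cdchart c i (cst z) p = 0.
Proof. by apply/eqP; rewrite eq_complex /= !dchart_cst !eqxx. Qed.

Lemma cdchartD c i f g p : cchart_smooth c f -> cchart_smooth c g -> cdom c p ->
  cdchart c i (f + g) p = cdchart c i f p + cdchart c i g p.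
Proof.
move=> [? ?] [? ?] cp; apply/eqP; rewrite eq_complex /=.
by rewrite -/(fRe (f + g)) -/(fIm (f + g)) fReD fImD !dchartD ?eqxx.
Qed.

Lemma cdchartM c i f g p : cchart_smooth c f -> cchart_smooth c g -> cdom c p ->
  cdchart c i (f * g) p = cdchart c i f p * g p + f p * cdchart c i g p.
Proof.
move=> [? ?] [? ?] cp; rewrite /cdchart.
rewrite -/(fRe (f * g)) -/(fIm (f * g)) -!/(fRe f) -!/(fIm f) -!/(fRe g) -!/(fIm g).
rewrite fReM fImM.
have sM u v : chart_smooth c u -> chart_smooth c v -> chart_smooth c (u * v) by exact: chart_smoothM.
rewrite (dchartD _ (sM _ _ _ _) (chart_smoothN (sM _ _ _ _))) // dchartN ?dchartM //; last exact: sM.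
rewrite (dchartD _ (sM _ _ _ _) (sM _ _ _ _)) // !dchartM //.
rewrite /fRe /fIm; case: (f p) => a b; case: (g p) => a' b' /=.
by apply/eqP; rewrite eq_complex /=; apply/andP; split; apply/eqP; ring.
Qed.

Lemma cdchart_near c i f g p : cdom c p -> (\forall q \near p, f q = g q) ->
  cdchart c i f p = cdchart c i g p.
Proof.
move=> cp fg.
have E1 : dchart c i (fRe f) p = dchart c i (fRe g) p.
  by apply: dchart_near => //; apply: filterS fg => q; rewrite /fRe => ->.
have E2 : dchart c i (fIm f) p = dchart c i (fIm g) p.
  by apply: dchart_near => //; apply: filterS fg => q; rewrite /fIm => ->.
by rewrite /cdchart -!/(fRe _) -!/(fIm _) E1 E2.
Qed.

Lemma cdchartC c i j f p : cchart_smooth c f -> cdom c p ->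
  cdchart c i (cdchart c j f) p = cdchart c j (cdchart c i f) p.
Proof.
move=> [sR sI] cp.
have E1 := dchartC i j sR cp; have E2 := dchartC i j sI cp.
by rewrite /cdchart /= -[LHS]/(dchart c i (dchart c j (fRe f)) p
  +i* dchart c i (dchart c j (fIm f)) p) E1 E2.
Qed.

Lemma cdchart_coord c i j p : cdom c p ->
  cdchart c j (fun q => (cmap c q 0 i)%:C) p = (i == j)%:R.
Proof.
move=> cp; rewrite /cdchart /= dchart_coord // dchart_cst.
by case: (i == j).
Qed.

Lemma cchart_smooth_iter c s f : cchart_smooth c f -> cchart_smooth c (iter_cdchart c s f).
Proof. by move=> sf; elim: s => //= i s IH; exact: cchart_smooth_cdchart. Qed.

Lemma iter_cdchart_near c s f g p : cdom c p -> (\forall q \near p, f q = g q) ->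
  iter_cdchart c s f p = iter_cdchart c s g p.
Proof.
move=> cp /nbhs_interior fg; have := nbhs_singleton fg.
elim: s p cp {fg} => [|i s IH] p cp fg; first exact: (nbhs_singleton fg).
rewrite /=; apply: cdchart_near => //.
have nc : \forall q \near p, cdom c q by apply: open_nbhs_nbhs; split=> //; exact: cdom_open.
apply: filterS (filterI nc (nbhs_interior fg)) => q [cq fgq]; exact: IH.
Qed.

End ComplexChartCalculus.

(** * Extension of functions from a chart *)

Section Extension.
Variables (R : realType) (m : nat) (M : topologicalType).
Variables (A : set (chart R m M)) (hA : smooth_structure A).

Lemma smoothP (f : M -> R[i]) : smooth A f <-> forall c, A c -> cchart_smooth c f.
Proof. by split=> H c Ac; apply/cchart_smoothP; exact: H. Qed.

(** The extension is chi f on the domain of c and 0 elsewhere, with chi a bump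
    function at p supported in a compact part K of the chart.  It is smooth at the
    points of the chart by the chain rule, and vanishes near all other points as K
    is closed in the Hausdorff space M.  The neighbourhood U, where chi = 1, does
    not depend on f. *)
Lemma smooth_extension c p : A c -> cdom c p ->
  exists U : set M, [/\ open U, U p, U `<=` cdom c &
    forall f, cchart_smooth c f -> exists2 F, smooth A F & forall q, U q -> F q = f q].
Proof.
move=> Ac cp; set x := cmap c p.
have [r0 /= r00 xr0] := (nbhs_ballP _ _).1 (near_cimg cp).
(* the closed ball of radius r0 / 2 lies inside the image of the chart *)
pose r := r0 / 2.
have rp : 0 < r by rewrite divr_gt0.
pose D := [set y : 'rV[R]_m | `|x - y| <= r].
have DW : D `<=` cimg c.
  move=> y Dy; apply: xr0; rewrite -ball_normE /=; apply: le_lt_trans Dy _.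
  by rewrite /r ltr_pdivrMr // ltr_pMr // ltr1n.
have [chi [cchi chi1 chi0]] := bump_function x rp.
have cD : compact D.
  apply: bounded_closed_compact.
    exists (`|x| + r); split; first exact: num_real.
    move=> t xt y /= Dy; apply: le_trans (ltW xt).
    rewrite -[y](subKr x); apply: le_trans (ler_normB _ _) _; exact: lerD.
  exact: closed_closed_ball_.
have cK : closed (cinv c @` D).
  apply: compact_closed; first exact: ss_hausdorff hA.
  apply: continuous_compact => //; apply: continuous_in_subspaceT => y.
  by rewrite inE => /DW; exact: cinv_continuous.
pose U := interior [set q | cdom c q /\ chi (cmap c q) = 1].
exists U; split.
- exact: open_interior.
- apply: (filterI (open_nbhs_nbhs _) (near_cmap cp chi1)).
  by split => //; exact: cdom_open.
- by move=> q /interior_subset [].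
move=> f [sRe sIm].
pose F q := if `[< cdom c q >] then (chi (cmap c q))%:C * f q else 0.
exists F; last first.
  by move=> q /interior_subset [cq chiq]; rewrite /F asboolT // chiq mul1r.
apply/smoothP => c' Ac'.
(* chi is real, so real and imaginary parts are cut off separately *)
suff gen (u : M -> R) : chart_smooth c u ->
    chart_smooth c' (fun q => if `[< cdom c q >] then chi (cmap c q) * u q else 0).
  split.
    have -> : fRe F = (fun q => if `[< cdom c q >] then chi (cmap c q) * fRe f q else 0).
      apply/funext => q; rewrite /fRe /F; case: ifP => // _.
      by case: (f q) => a b /=; rewrite mul0r subr0.
    exact: gen.
  have -> : fIm F = (fun q => if `[< cdom c q >] then chi (cmap c q) * fIm f q else 0).
    apply/funext => q; rewrite /fIm /F; case: ifP => // _.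
    by case: (f q) => a b /=; rewrite mul0r addr0.
  exact: gen.
move=> su k; apply: Ck_local => _ [q c'q <-].
(* inside the chart c the function is a composition with the transition map;
   outside it vanishes on the complement of the compact set *)
have [cq|ncq] := pselect (cdom c q).
  exists (cmap c' @` (cdom c' `&` cdom c)); split.
  - by rewrite setIC; apply: open_chart_image; exact: cdom_open.
  - by exists q.
  have oW' : open (cmap c' @` (cdom c' `&` cdom c)).
    by rewrite setIC; apply: open_chart_image; exact: cdom_open.
  apply: (@Ck_eq _ _ _ _ ((chi * (u \o cinv c)) \o (cmap c \o cinv c'))) => //.
    move=> _ [z [c'z cz] <-]; rewrite /= !fctE /= !cmapK // asboolT //.
  apply: (@Ck_comp _ _ _ _ _ (cimg c)) => //.
  - by move=> _ [z [c'z cz] <-]; rewrite /= cmapK //; exact: cimg_cmap.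
  - move=> j; have [/(_ j) + _] := ss_compatible hA Ac' Ac.
    by move=> /smooth_onP /(_ k).
  - apply: CkM => //; first exact: cimg_open.
    exact: Ck_sub (cchi k).
exists (cmap c' @` (~` (cinv c @` D) `&` cdom c')); split.
- by apply: open_chart_image; exact: closed_openC.
- exists q => //; split => // -[y /DW Wy E]; apply: ncq; rewrite -E; exact: cinv_dom.
have oW' : open (cmap c' @` (~` (cinv c @` D) `&` cdom c')).
  by apply: open_chart_image; exact: closed_openC.
apply: (@Ck_eq _ _ _ _ (cst 0)) => //; last exact: Ck_cst.
move=> _ [z [nKz c'z] <-]; rewrite /= cmapK //.
case: ifP => // /asboolP cz; rewrite chi0 ?mul0r // distrC ltNge.
apply/negP => Dz; apply: nKz; exists (cmap c z) => //; exact: cmapK.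
Qed.

End Extension.

(** * Jets at a point *)

Section Jets.
Variables (R : realType) (m : nat) (M : topologicalType) (c : chart R m M).
Implicit Types (f g : M -> R[i]) (s w : seq 'I_m) (p q : M).
Implicit Types (l : seq (R[i] * seq 'I_m)).

Lemma near_cdom p : cdom c p -> \forall q \near p, cdom c q.
Proof. by move=> cp; apply: open_nbhs_nbhs; split=> //; exact: cdom_open. Qed.

Lemma cdchart_dom i f g p : cdom c p -> (forall q, cdom c q -> f q = g q) ->
  cdchart c i f p = cdchart c i g p.
Proof.
by move=> cp fg; apply: cdchart_near => //; apply: filterS (near_cdom cp).
Qed.

Lemma cchart_smooth_sum (I : Type) (r : seq I) (P : pred I) (F : I -> M -> R[i]) :
  (forall j, cchart_smooth c (F j)) -> cchart_smooth c (\sum_(j <- r | P j) F j).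
Proof.
move=> sF; elim: r => [|j r IH]; rewrite ?big_nil ?big_cons.
  exact: cchart_smooth_cst.
by case: (P j) => //; exact: cchart_smoothD.
Qed.

Lemma cdchart_sum i (I : Type) (r : seq I) (F : I -> M -> R[i]) p :
  (forall j, cchart_smooth c (F j)) -> cdom c p ->
  cdchart c i (\sum_(j <- r) F j) p = \sum_(j <- r) cdchart c i (F j) p.
Proof.
move=> sF cp; elim: r => [|j r IH]; rewrite ?big_nil ?big_cons.
  exact: cdchart_cst.
by rewrite cdchartD ?IH //; exact: cchart_smooth_sum.
Qed.

(** The ways to distribute the letters of a word over two words, as in the
    iterated Leibniz rule. *)
Fixpoint splits s : seq (seq 'I_m * seq 'I_m) :=
  if s is i :: s' then
    [seq (i :: u.1, u.2) | u <- splits s'] ++ [seq (u.1, i :: u.2) | u <- splits s']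
  else [:: ([::], [::])].

Lemma iter_cdchartM s f g p : cchart_smooth c f -> cchart_smooth c g -> cdom c p ->
  iter_cdchart c s (f * g) p =
    \sum_(u <- splits s) iter_cdchart c u.1 f p * iter_cdchart c u.2 g p.
Proof.
move=> sf sg; elim: s p => [|i s IH] p cp; first by rewrite big_seq1.
rewrite /= (@cdchart_dom i _
  (\sum_(u <- splits s) (iter_cdchart c u.1 f * iter_cdchart c u.2 g))) //; last first.
  by move=> q cq; rewrite fct_sumE [LHS]IH.
rewrite cdchart_sum //; last by move=> u; apply: cchart_smoothM; exact: cchart_smooth_iter.
rewrite big_cat !big_map /= -big_split /=; apply: eq_bigr => u _.
by rewrite cdchartM //; exact: cchart_smooth_iter.
Qed.

Lemma iter_cdchartC s i f p : cchart_smooth c f -> cdom c p ->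
  iter_cdchart c s (cdchart c i f) p = cdchart c i (iter_cdchart c s f) p.
Proof.
move=> sf; elim: s p => //= j s IH p cp.
by rewrite (cdchart_dom j cp IH) cdchartC //; exact: cchart_smooth_iter.
Qed.

(** The words obtained by deleting one occurrence of the letter i.  They index the
    terms of the commutator of an iterated derivative with the i-th coordinate. *)
Fixpoint delete_letter (i : 'I_m) s : seq (seq 'I_m) :=
  if s is a :: s' then
    (if a == i then [:: s'] else [::]) ++ [seq a :: w | w <- delete_letter i s']
  else [::].

Lemma size_delete_letter i s w : w \in delete_letter i s -> (size w).+1 = size s.
Proof.
elim: s w => //= a s IH w; rewrite mem_cat => /orP[|/mapP[w' /IH <- ->]] //.
by case: ifP => // _; rewrite inE => /eqP ->.
Qed.

(** Deleting a letter and differentiating along it again gives back the derivative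
    along s, as partial derivatives commute; there are size s positions to delete. *)
Lemma euler_identity s f p : cchart_smooth c f -> cdom c p ->
  \sum_(i < m) \sum_(w <- delete_letter i s) iter_cdchart c w (cdchart c i f) p
  = (size s)%:R * iter_cdchart c s f p.
Proof.
move=> sf; elim: s p => [|a s IH] p cp.
  by rewrite mul0r big1 // => i _; rewrite big_nil.
under eq_bigr do rewrite /= big_cat big_map /=.
rewrite big_split /= -natr1 mulrDl mul1r addrC; congr (_ + _).
  rewrite -[RHS]/((size s)%:R * cdchart c a (iter_cdchart c s f) p).
  have -> : (size s)%:R * cdchart c a (iter_cdchart c s f) p =
      cdchart c a (cst (size s)%:R * iter_cdchart c s f) p.
    rewrite cdchartM //; [|exact: cchart_smooth_cst|exact: cchart_smooth_iter].
    by rewrite cdchart_cst mul0r add0r.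
  rewrite -(@cdchart_dom a
    (\sum_(i < m) \sum_(w <- delete_letter i s) iter_cdchart c w (cdchart c i f))) //.
    rewrite cdchart_sum //; last first.
      by move=> i; apply: cchart_smooth_sum => w; apply: cchart_smooth_iter; exact: cchart_smooth_cdchart.
    apply: eq_bigr => i _; rewrite cdchart_sum // => w.
    by apply: cchart_smooth_iter; exact: cchart_smooth_cdchart.
  move=> q cq; rewrite fct_sumE -[RHS]/((size s)%:R * iter_cdchart c s f q) -IH //.
  by apply: eq_bigr => i _; rewrite fct_sumE.
rewrite (bigD1 a) //= eqxx big_seq1 iter_cdchartC // big1 ?addr0 // => i ia.
by rewrite eq_sym (negbTE ia) big_nil.
Qed.

Lemma iter_cdchart_mul_coord s i (xi : M -> R[i]) f p :
  cchart_smooth c xi -> (forall j q, cdom c q -> cdchart c j xi q = (i == j)%:R) ->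
  cchart_smooth c f -> cdom c p ->
  iter_cdchart c s (xi * f) p =
    xi p * iter_cdchart c s f p + \sum_(w <- delete_letter i s) iter_cdchart c w f p.
Proof.
move=> sx dx sf; elim: s p => [|a s IH] p cp; first by rewrite big_nil addr0.
rewrite /= (@cdchart_dom a _
  (xi * iter_cdchart c s f + \sum_(w <- delete_letter i s) iter_cdchart c w f)) //; last first.
  by move=> q cq; rewrite [LHS]IH // -[RHS]/(xi q * _ + _) fct_sumE.
have sw w : cchart_smooth c (iter_cdchart c w f) by exact: cchart_smooth_iter.
rewrite cdchartD //; [|exact: cchart_smoothM|exact: cchart_smooth_sum].
rewrite cdchartM // cdchart_sum // dx // big_cat big_map /= addrA; congr (_ + _).
rewrite addrC; congr (_ + _); rewrite eq_sym.
by case: (a == i); rewrite ?big_seq1 ?mul1r ?big_nil ?mul0r.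
Qed.

(** The functional f |-> sum_s b_s (d_s f)(p), given by a list of coefficients and
    words. *)
Definition jet l f p := \sum_(b <- l) b.1 * iter_cdchart c b.2 f p.

Definition jet_component d l f p :=
  \sum_(b <- l | size b.2 == d) b.1 * iter_cdchart c b.2 f p.

Lemma jet_near l f g p : cdom c p -> (\forall q \near p, f q = g q) ->
  jet l f p = jet l g p.
Proof.
by move=> cp fg; apply: eq_bigr => b _; rewrite (iter_cdchart_near _ cp fg).
Qed.

Lemma jet_lin l f g (a b : R[i]) p : cchart_smooth c f -> cchart_smooth c g -> cdom c p ->
  jet l (cst a * f + cst b * g) p = a * jet l f p + b * jet l g p.
Proof.
move=> sf sg cp; rewrite /jet !mulr_sumr -big_split; apply: eq_bigr => d _ /=.
rewrite mulrCA [b * _]mulrCA -mulrDr; congr (_ * _).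
elim: (d.2) p cp => // i s IH p cp /=.
rewrite (cdchart_dom (g := cst a * iter_cdchart c s f + cst b * iter_cdchart c s g) i cp) //.
have ss h : cchart_smooth c h -> cchart_smooth c (iter_cdchart c s h) by exact: cchart_smooth_iter.
have sz z h : cchart_smooth c h -> cchart_smooth c (cst z * iter_cdchart c s h).
  by move=> sh; apply: cchart_smoothM; [exact: cchart_smooth_cst|exact: ss].
rewrite cdchartD; [|exact: sz|exact: sz|by []].
rewrite !cdchartM; auto using cchart_smooth_cst.
by rewrite !cdchart_cst !mul0r !add0r.
Qed.

Lemma jet_sum_components N l f p : all (fun b => (size b.2 < N)%N) l ->
  jet l f p = \sum_(d < N) jet_component d l f p.
Proof.
rewrite /jet /jet_component; elim: l => [|b l IH] /=.
  by move=> _; rewrite big_nil big1 // => d _; rewrite big_nil.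
case/andP=> bN /IH {}IH; rewrite big_cons IH.
rewrite (bigD1 (Ordinal bN)) //= [RHS](bigD1 (Ordinal bN)) //= big_cons eqxx addrA.
congr (_ + _); apply: eq_bigr => d dN; rewrite big_cons.
by case: eqP => // E; move: dN; rewrite -val_eqE /= -E eqxx.
Qed.

Definition centred_coord p (i : 'I_m) : M -> R[i] := fun q => (cmap c q 0 i - cmap c p 0 i)%:C.

Lemma centred_coordE p i : centred_coord p i =
  (fun q => (cmap c q 0 i)%:C) + cst (- (cmap c p 0 i)%:C).
Proof. by apply/funext => q; rewrite /centred_coord raddfB. Qed.

Lemma cchart_smooth_centred_coord p i : cchart_smooth c (centred_coord p i).
Proof.
by rewrite centred_coordE; apply: cchart_smoothD;
  [exact: cchart_smooth_coord|exact: cchart_smooth_cst].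
Qed.

Lemma cdchart_centred_coord p i j q : cdom c q -> cdchart c j (centred_coord p i) q = (i == j)%:R.
Proof.
move=> cq; rewrite centred_coordE cdchartD //; [|exact: cchart_smooth_coord|exact: cchart_smooth_cst].
by rewrite cdchart_coord // cdchart_cst addr0.
Qed.

(** The list that represents f |-> jet l (x_i f), with x_i centred at p; it
    consists of shorter words. *)
Definition jet_lower_word (i : 'I_m) l := [seq (b.1, w) | b <- l, w <- delete_letter i b.2].

Lemma jet_lower i l f p : cchart_smooth c f -> cdom c p ->
  jet l (centred_coord p i * f) p = jet (jet_lower_word i l) f p.
Proof.
move=> sf cp; rewrite /jet big_allpairs_dep; apply: eq_bigr => b _.
rewrite (@iter_cdchart_mul_coord _ i) //; [|exact: cchart_smooth_centred_coord|].
  by rewrite {1}/centred_coord subrr mul0r add0r mulr_sumr.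
by move=> j q; exact: cdchart_centred_coord.
Qed.

(** By [euler_identity] the components of positive degree of a jet are recovered
    from those of the jets f |-> jet l (x_i f). *)
Lemma jet_component_lower d l f p : cchart_smooth c f -> cdom c p ->
  d.+1%:R * jet_component d.+1 l f p =
  \sum_(i < m) jet_component d (jet_lower_word i l) (cdchart c i f) p.
Proof.
move=> sf cp; rewrite /jet_component mulr_sumr.
transitivity (\sum_(i < m) \sum_(b <- l | size b.2 == d.+1)
    \sum_(w <- delete_letter i b.2) b.1 * iter_cdchart c w (cdchart c i f) p).
  rewrite exchange_big /=; apply: eq_bigr => b /eqP bd.
  rewrite mulrCA -bd -euler_identity // mulr_sumr; apply: eq_bigr => i _.
  by rewrite mulr_sumr.
apply: eq_bigr => i _; rewrite big_mkcond [RHS]big_mkcond big_allpairs_dep /=.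
apply: eq_bigr => b _; case: ifPn => bd.
  rewrite !big_seq; apply: eq_bigr => w /size_delete_letter E.
  by rewrite -eqSS E bd.
rewrite big_seq big1 // => w /size_delete_letter E.
by rewrite -eqSS E (negbTE bd).
Qed.

Definition mul_centred_coords p (r : seq 'I_m) f := foldr (fun i g => centred_coord p i * g) f r.

Lemma cchart_smooth_mul_centred_coords p r f : cchart_smooth c f ->
  cchart_smooth c (mul_centred_coords p r f).
Proof.
by move=> sf; elim: r => //= i r IH; apply: cchart_smoothM => //;
  exact: cchart_smooth_centred_coord.
Qed.

(** Induction on the length of the words.  The jets f |-> jet l (x_i f) are
    shorter and satisfy the hypothesis with r - 1 factors, so their components of
    degree >= r - 1 vanish, and [jet_component_lower] gives the components of degree
    >= r of the jet itself, apart from degree 0.  That one only matters for r = 0,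
    and then it is what remains of a vanishing jet. *)
Lemma jet_truncate N r l p : cdom c p -> all (fun b => (size b.2 < N)%N) l ->
  (forall e f, size e = r -> cchart_smooth c f -> jet l (mul_centred_coords p e f) p = 0) ->
  forall d f, (r <= d)%N -> cchart_smooth c f -> jet_component d l f p = 0.
Proof.
move=> cp; elim: N r l => [|N IH] r l lN H.
  by case: l lN {H} => //= _ d f _ _; rewrite /jet_component big_nil.
(* positive degrees; for r = 0 the index r.-1 = 0 is used, as the jets
   f |-> jet l (x_i f) vanish as well *)
have succ d f : (r <= d.+1)%N -> cchart_smooth c f -> jet_component d.+1 l f p = 0.
  move=> rd sf; have d0 : (d.+1%:R : R[i]) != 0 by rewrite pnatr_eq0.
  apply: (mulfI d0); rewrite mulr0 jet_component_lower // big1 // => i _.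
  apply: (IH r.-1); last exact: cchart_smooth_cdchart.
  - apply/allP => _ /allpairsPdep [b [w [bl wb ->]]] /=.
    by rewrite -ltnS (size_delete_letter wb); exact: (allP lN).
  - move=> e g se sg; rewrite -jet_lower //; last exact: cchart_smooth_mul_centred_coords.
    case: r H {rd} se => [|r] H se; last by apply: (H (i :: e)) => //=; rewrite se.
    case: e se => // _; apply: (H [::] (centred_coord p i * g)) => //.
    by apply: cchart_smoothM => //; exact: cchart_smooth_centred_coord.
  - by case: (r) rd.
case=> [|d] f rd sf; last exact: succ.
have r0 : r = 0%N by apply/eqP; rewrite -leqn0.
have := H [::] f; rewrite r0 => /(_ erefl sf) /=.
rewrite (jet_sum_components _ _ lN) big_ord_recl big1 ?addr0 // => i _.
by apply: succ => //; rewrite r0.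
Qed.

Lemma jet_bounded l : exists N, all (fun b : R[i] * seq 'I_m => (size b.2 < N)%N) l.
Proof.
exists (\max_(b <- l) size b.2).+1; apply/allP => b bl.
by rewrite ltnS; exact: (@leq_bigmax_seq _ _ xpredT (fun b : R[i] * seq 'I_m => size b.2)).
Qed.

(** The case r = 1 of [jet_truncate]: only the component of degree 0 remains. *)
Lemma jet_scalar l p : cdom c p ->
  (forall i f, cchart_smooth c f -> jet l (centred_coord p i * f) p = 0) ->
  exists z, forall f, cchart_smooth c f -> jet l f p = z * f p.
Proof.
move=> cp H; have [N lN] := jet_bounded l.
have D d f : cchart_smooth c f -> jet_component d.+1 l f p = 0.
  move=> sf; apply: (jet_truncate cp lN (r := 1)) => // -[|i []] //= g _ sg.
  exact: H.
exists (\sum_(b <- l | size b.2 == 0) b.1) => f sf.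
have lN' : all (fun b : R[i] * seq 'I_m => (size b.2 < N.+1)%N) l.
  by apply: sub_all lN => b bN; exact: ltnW.
rewrite (jet_sum_components _ _ lN') big_ord_recl big1 ?addr0; last by move=> d _; exact: D.
rewrite /jet_component mulr_suml; apply: eq_bigr => b.
by rewrite size_eq0 => /eqP ->.
Qed.

End Jets.

(** * Orders of operators *)

Section GrothendieckOrder.
Variables (K : comNzRingType) (M : Type) (S : (M -> K) -> Prop) (U : set M).
Hypothesis SM : forall f g, S f -> S g -> S (f * g).
Hypothesis SB : forall f g, S f -> S g -> S (f - g).
Hypothesis S1 : S 1.
Implicit Types (f g h : M -> K) (D A B : (M -> K) -> M -> K).

(** The commutator of D with the multiplication by h. *)
Definition ad h D : (M -> K) -> M -> K := fun f => D (h * f) - h * D f.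

Definition eq_on D D' := forall f, S f -> forall p, U p -> D f p = D' f p.

(** Order less than k on U, in the sense of Grothendieck.  Order less than 0 is
    vanishing; an operator commuting with all multiplications has order less
    than 1. *)
Fixpoint order_lt (k : nat) D : Prop :=
  if k is k'.+1 then forall h, S h -> order_lt k' (ad h D)
  else forall f, S f -> forall p, U p -> D f p = 0.

Lemma adE h D f p : ad h D f p = D (h * f) p - h p * D f p.
Proof. by []. Qed.

Lemma fmulE f g p : (f * g) p = f p * g p. Proof. by []. Qed.
Lemma fsubE f g p : (f - g) p = f p - g p. Proof. by []. Qed.
Lemma faddE f g p : (f + g) p = f p + g p. Proof. by []. Qed.
Lemma foppE f p : (- f) p = - f p. Proof. by []. Qed.

Lemma adC h h' D : ad h (ad h' D) = ad h' (ad h D).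
Proof.
apply/funext => f; apply/funext => p; rewrite !adE mulrCA; ring.
Qed.

Lemma ad_eq_on h D D' : S h -> eq_on D D' -> eq_on (ad h D) (ad h D').
Proof.
move=> Sh DD' f Sf p Up.
by rewrite !adE !DD' //; exact: SM.
Qed.

Lemma order_lt_eq_on k D D' : eq_on D D' -> order_lt k D -> order_lt k D'.
Proof.
elim: k D D' => [|k IH] D D' DD' H.
  by move=> f Sf p Up; rewrite -DD' //; exact: H.
by move=> h Sh; apply: IH (H _ Sh); exact: ad_eq_on.
Qed.

Lemma order_ltS k D : order_lt k D -> order_lt k.+1 D.
Proof.
elim: k D => [|k IH] D H h Sh; last exact: IH (H _ Sh).
by move=> f Sf p Up; rewrite adE !H ?mulr0 ?subr0 //; exact: SM.
Qed.

Lemma order_lt0 k D : order_lt 0 D -> order_lt k D.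
Proof. by move=> H; elim: k => // k; exact: order_ltS. Qed.

Lemma order_ltD k D D' : order_lt k D -> order_lt k D' -> order_lt k (fun f => D f + D' f).
Proof.
elim: k D D' => [|k IH] D D' H H'.
  by move=> f Sf p Up; rewrite faddE H // H' // addr0.
move=> h Sh; apply: order_lt_eq_on (IH _ _ (H h Sh) (H' h Sh)) => f Sf p Up.
by rewrite !(adE, faddE, foppE, fsubE); ring.
Qed.

Lemma order_ltN k D : order_lt k D -> order_lt k (fun f => - D f).
Proof.
elim: k D => [|k IH] D H.
  by move=> f Sf p Up; rewrite foppE H // oppr0.
move=> h Sh; apply: order_lt_eq_on (IH _ (H h Sh)) => f Sf p Up.
by rewrite !(adE, faddE, foppE, fsubE); ring.
Qed.

Lemma order_ltZ k u D : order_lt k D -> order_lt k (fun f => u * D f).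
Proof.
elim: k D => [|k IH] D H.
  by move=> f Sf p Up; rewrite fmulE H // mulr0.
move=> h Sh; apply: order_lt_eq_on (IH _ (H h Sh)) => f Sf p Up.
by rewrite !(adE, fmulE, fsubE); ring.
Qed.

Lemma order_lt_sum k n (D : 'I_n -> (M -> K) -> M -> K) : (forall i, order_lt k (D i)) ->
  order_lt k (fun f => \sum_(i < n) D i f).
Proof.
elim: n D => [|n IH] D H.
  by apply: order_lt0 => f _ p _; rewrite big_ord0.
have := order_ltD (H ord0) (IH _ (fun i => H (lift ord0 i))).
by apply: order_lt_eq_on => f Sf p Up; rewrite big_ord_recl.
Qed.

(** What the rules for commutators need: D f on U depends on f on U only, additively. *)
Record local_op D : Prop := LocalOp {
  op_S : forall f, S f -> S (D f);
  opB : forall f g, S f -> S g -> forall p, U p -> D (f - g) p = D f p - D g p;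
  op_zero : forall f, S f -> (forall p, U p -> f p = 0) ->
    forall p, U p -> D f p = 0
}.

Lemma op_congr D f g : local_op D -> S f -> S g ->
  (forall p, U p -> f p = g p) -> forall p, U p -> D f p = D g p.
Proof.
move=> oD Sf Sg fg p Up; apply/eqP; rewrite -subr_eq0 -(opB oD) //.
apply/eqP; apply: (op_zero oD) => //; first exact: SB.
by move=> q Uq; rewrite fsubE fg // subrr.
Qed.

Lemma local_op_ad h D : S h -> local_op D -> local_op (ad h D).
Proof.
move=> Sh oD; split.
- by move=> f Sf; apply: SB; [apply: (op_S oD)|apply: SM => //; apply: (op_S oD)] => //; exact: SM.
- move=> f g Sf Sg p Up; rewrite !adE mulrBr.
  by rewrite (opB oD (SM Sh Sf) (SM Sh Sg)) // (opB oD) //; ring.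
- move=> f Sf f0 p Up; rewrite adE (op_zero oD Sf f0) // mulr0 subr0.
  by apply: (op_zero oD) => //; [exact: SM|move=> q Uq; rewrite fmulE f0 // mulr0].
Qed.

Definition commutator A B : (M -> K) -> M -> K := fun f => A (B f) - B (A f).

Lemma commutatorE A B f p : commutator A B f p = A (B f) p - B (A f) p.
Proof. by []. Qed.

Lemma commutator0l A B : local_op B -> local_op A -> order_lt 0 A -> order_lt 0 (commutator A B).
Proof.
move=> oB oA A0 f Sf p Up; rewrite !commutatorE A0 //; last exact: op_S oB _ Sf.
by rewrite (op_zero oB) ?subrr //; [exact: op_S oA _ Sf|exact: A0].
Qed.

Lemma commutator0r A B : local_op B -> local_op A -> order_lt 0 B -> order_lt 0 (commutator A B).
Proof.
move=> oB oA B0; have := order_ltN (commutator0l oA oB B0).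
by apply: order_lt_eq_on => f Sf p Up; rewrite !commutatorE opprB.
Qed.

(** An operator of order 0 is the multiplication by its value at 1. *)
Lemma order_lt1 A f : order_lt 1 A -> S f -> forall p, U p -> A f p = f p * A 1 p.
Proof.
move=> A1 Sf p Up; apply/eqP; rewrite -subr_eq0 -{1}[f]mulr1.
by apply/eqP; exact: (A1 _ Sf).
Qed.

(** Orders a and b give a commutator of order at most a + b - 1.  Operators of order
    0 are multiplications and commute; the general case follows by induction from
    the Leibniz rule for [ad h]. *)
Lemma order_lt_commutator a b A B : local_op A -> local_op B ->
  order_lt a.+1 A -> order_lt b.+1 B -> order_lt (a + b) (commutator A B).
Proof.
move En : (a + b)%N => n; elim: n a b A B En => [|n IH] a b A B En oA oB HA HB.
  have [a0 b0] : a = 0%N /\ b = 0%N by case: a b En {HA HB} => [|a] [|b].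
  subst a b => f Sf p Up; rewrite !commutatorE.
  rewrite (order_lt1 HA (op_S oB Sf) Up) (order_lt1 HB (op_S oA Sf) Up).
  by rewrite (order_lt1 HA Sf Up) (order_lt1 HB Sf Up); ring.
move=> h Sh.
have oA' := local_op_ad Sh oA; have oB' := local_op_ad Sh oB.
have HA' : order_lt n (commutator (ad h A) B).
  case: a En HA => [|a] En HA; first by apply/order_lt0/commutator0l => //; exact: HA.
  by apply: (IH a b) => //; [move: En => [->]|exact: HA].
have HB' : order_lt n (commutator A (ad h B)).
  case: b En HB => [|b] En HB; first by apply/order_lt0/commutator0r => //; exact: HB.
  by apply: (IH a b) => //; [move: En; rewrite addnS => -[->]|exact: HB].
apply: order_lt_eq_on (order_ltD HA' HB') => f Sf p Up; rewrite faddE !(commutatorE, adE) /ad.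
have SAf := op_S oA Sf; have SBf := op_S oB Sf.
have SAh := op_S oA (SM Sh Sf); have SBh := op_S oB (SM Sh Sf).
rewrite (opB oA SBh (SM Sh SBf)) // (opB oB SAh (SM Sh SAf)) //; ring.
Qed.

(** Taking commutators with X_1, .., X_k, all terms but one contain a factor
    X_i(p) = 0. *)
Lemma order_lt_vanish k D (I : Type) (X : I -> M -> K) (e : seq I) f p :
  (forall i, S (X i)) -> (forall i, X i p = 0) -> order_lt k D -> U p -> S f ->
  size e = k -> D (foldr (fun i g => X i * g) f e) p = 0.
Proof.
move=> SX X0 + Up Sf.
elim: k D e => [|k IH] D [|i e] //= HD; first by move=> _; exact: HD.
move=> [se]; have := IH _ e (HD _ (SX i)) se.
by rewrite adE X0 mul0r subr0.
Qed.

Section Associative.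
Variables (C : nat -> (M -> K) -> (M -> K) -> M -> K).
Variables (I J : Type) (zeta : I -> M -> K) (eta : J -> M -> K).
Variable good : ((M -> K) -> M -> K) -> Prop.

Hypothesis good_op : forall D, good D -> local_op D.
Hypothesis good_ad : forall h D, S h -> good D -> good (ad h D).
Hypothesis good_order_lt : forall k D, good D ->
  (forall i, order_lt k (ad (zeta i) D)) -> (forall j, order_lt k (ad (eta j) D)) ->
  order_lt k.+1 D.
Hypothesis goodl : forall r f, S f -> good (C r f).
Hypothesis goodr : forall r f, S f -> good (fun g => C r g f).
Hypothesis C0 : forall f g, S f -> S g -> forall p, U p -> C 0 f g p = f p * g p.
Hypothesis CA : forall r f g h, S f -> S g -> S h -> forall p, U p ->
  \sum_(s < r.+1) C (r - s) f (C s g h) p = \sum_(s < r.+1) C (r - s) (C s f g) h p.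
Hypothesis Szeta : forall i, S (zeta i).
Hypothesis Seta : forall j, S (eta j).
Hypothesis Czeta : forall r i f, S f -> forall p, U p -> C r.+1 f (zeta i) p = 0.
Hypothesis Ceta : forall r j f, S f -> forall p, U p -> C r.+1 (eta j) f p = 0.

Let L f r := C r f.
Let Q h r := fun g => C r g h.

(** The coefficient of degree r.+1 of associativity: the sum of the commutators of
    C_(r+1-s)(f, .) and C_s(., h) over all s vanishes.  The terms s = 0 and s = r.+1
    are commutators with the multiplications by h and f. *)
Lemma ad_coefficients r f h : S f -> S h ->
  eq_on (fun g => \sum_(s < r) - commutator (L f (r - s)) (Q h s.+1) g)
      (fun g => ad h (L f r.+1) g - ad f (Q h r.+1) g).
Proof.
move=> Sf Sh g Sg p Up.
have Sgh s : S (C s g h) by apply: (op_S (good_op (goodr s Sh))).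
have Sfg s : S (C s f g) by apply: (op_S (good_op (goodl s Sf))).
have : \sum_(s < r.+2) commutator (L f (r.+1 - s)) (Q h s) g p = 0.
  rewrite /L /Q; under eq_bigr do rewrite commutatorE.
  rewrite sumrB CA // [X in _ - X](reindex_inj rev_ord_inj) /=.
  rewrite -sumrB big1 // => s _.
  have sr : (s <= r.+1)%N by rewrite -ltnS.
  by rewrite subSS subKn // subrr.
rewrite big_ord_recl big_ord_recr /= subn0 subnn.
have -> : commutator (L f r.+1) (Q h 0) g p = ad h (L f r.+1) g p.
  rewrite !(commutatorE, adE) /L /Q C0 // [h p * _]mulrC; congr (_ - _).
  apply: (op_congr (good_op (goodl _ Sf))) => //; first exact: SM.
  by move=> q Uq; rewrite C0 // fmulE mulrC.
have -> : commutator (L f 0) (Q h r.+1) g p = - ad f (Q h r.+1) g p.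
  rewrite !(commutatorE, adE) /L /Q C0 // opprB; congr (_ - _).
  apply: (op_congr (good_op (goodr _ Sh))) => //; first exact: SM.
  by move=> q Uq; rewrite C0 // fmulE.
move=> E; rewrite fct_sumE fsubE.
under eq_bigr do rewrite foppE.
rewrite sumrN; move: E; set T := \sum_(i < r) _ => E.
transitivity (- T); first by congr (- _); exact: eq_bigr.
by apply/eqP; rewrite eq_sym -addr_eq0 -E addrAC addrA.
Qed.

(** In [ad_coefficients] all commutators involve some C_s(., zeta i) with s >= 1. *)
Lemma ad_zeta r f i : S f -> order_lt 0 (ad (zeta i) (L f r.+1)).
Proof.
move=> Sf g Sg p Up.
have E := ad_coefficients r Sf (Szeta i) Sg Up.
have Q0 s : order_lt 0 (Q (zeta i) s.+1) by move=> k Sk q Uq; exact: Czeta.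
move: E; rewrite fsubE [ad f _ _ _](order_ltS (Q0 r) Sf) // subr0 => <-.
rewrite fct_sumE big1 // => s _; rewrite foppE.
rewrite (commutator0r _ _ (Q0 s)) ?oppr0 //; apply: good_op; [exact: goodr|exact: goodl].
Qed.

(** In [ad_coefficients] all commutators involve some C_s(eta j, .) with s >= 1. *)
Lemma ad_eta r h j : S h -> order_lt 0 (ad (eta j) (Q h r.+1)).
Proof.
move=> Sh g Sg p Up.
have E := ad_coefficients r (Seta j) Sh Sg Up.
have L0 s : order_lt 0 (L (eta j) s.+1) by move=> k Sk q Uq; exact: Ceta.
move: E; rewrite fsubE [ad h _ _ _](order_ltS (L0 r) Sh) // sub0r => E.
rewrite -[LHS]opprK -E fct_sumE big1 ?oppr0 // => s _; rewrite foppE.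
have -> : (r - s)%N = (r - s.+1).+1 by rewrite -subSn.
rewrite (commutator0l _ _ (L0 _)) ?oppr0 //; apply: good_op; [exact: goodr|exact: goodl].
Qed.

(** The main induction.  In the application zeta and eta are the holomorphic and the
    antiholomorphic coordinates, or conversely, and good D says that D is a
    differential operator. *)
Lemma order_lt_coefficients r f : S f -> order_lt r.+1 (L f r) /\ order_lt r.+1 (Q f r).
Proof.
have [n] := ubnP r; elim: n r f => // n IH r f rn Sf.
case: r rn => [|r] rn.
  split=> h Sh g Sg p Up; rewrite !adE /L /Q !C0 //; try exact: SM.
    by rewrite fmulE mulrCA subrr.
  by rewrite fmulE mulrA subrr.
(* by induction the commutator of L f' (r - s) and Q h s.+1 has order at most
   (r - s) + (s + 1) - 1 = r *)
have star f' h : S f' -> S h ->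
    order_lt r.+1 (fun g => ad h (L f' r.+1) g - ad f' (Q h r.+1) g).
  move=> Sf' Sh; apply: order_lt_eq_on (ad_coefficients r Sf' Sh) _.
  apply: order_lt_sum => s; apply: order_ltN.
  have -> : r.+1 = ((r - s) + s.+1)%N by rewrite addnS subnK // ltnW.
  apply: order_lt_commutator.
  - by apply: good_op; exact: goodl.
  - by apply: good_op; exact: goodr.
  - apply: (proj1 (IH _ _ _ Sf')); rewrite -ltnS; apply: leq_ltn_trans rn.
    by rewrite ltnS leq_subr.
  - by apply: (proj2 (IH _ _ _ Sh)); exact: leq_ltn_trans (ltn_ord s) rn.
(* X commutes with the zeta; its commutators with the eta are those of X - Y,
   since Y commutes with the eta *)
have X i j : order_lt r.+1 (ad (eta j) (L (zeta i) r.+1)).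
  apply: good_order_lt; first by apply: good_ad => //; exact: goodl.
    by move=> k; rewrite adC; apply: (order_lt0 r.+1 (ad_zeta _ _ (Szeta i))).
  move=> k; have S1' := star _ _ (Szeta i) (Seta j) _ (Seta k).
  have S2' : order_lt r (ad (eta k) (ad (zeta i) (Q (eta j) r.+1))).
    by rewrite adC; apply: (order_lt0 r.+1 (ad_eta _ _ (Seta j))).
  apply: order_lt_eq_on (order_ltD S1' S2') => g Sg p Up.
  by rewrite !(adE, faddE, foppE, fsubE); ring.
have Y i j : order_lt r.+1 (ad (zeta i) (Q (eta j) r.+1)).
  apply: order_lt_eq_on (order_ltD (X i j) (order_ltN (star _ _ (Szeta i) (Seta j)))) => g Sg p Up.
  by rewrite !(faddE, foppE, fsubE); ring.
have Lz i : order_lt r.+2 (L (zeta i) r.+1).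
  apply: good_order_lt; [exact: goodl| |by move=> j; exact: X].
  by move=> k; apply: order_lt0; exact: ad_zeta.
have Qe j : order_lt r.+2 (Q (eta j) r.+1).
  apply: good_order_lt; [exact: goodr|by move=> i; exact: Y|].
  by move=> k; apply: order_lt0; exact: ad_eta.
split; apply: good_order_lt.
- exact: goodl.
- by move=> k; apply: order_lt0; exact: ad_zeta.
- move=> j; have Qf : order_lt r.+1 (ad f (Q (eta j) r.+1)) := Qe j f Sf.
  apply: order_lt_eq_on (order_ltD (star _ _ Sf (Seta j)) Qf) => g Sg p Up.
  by rewrite !(faddE, foppE, fsubE); ring.
- exact: goodr.
- move=> i; have Lf : order_lt r.+1 (ad f (L (zeta i) r.+1)) := Lz i f Sf.
  apply: order_lt_eq_on (order_ltD Lf (order_ltN (star _ _ (Szeta i) Sf))) => g Sg p Up.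
  by rewrite !(faddE, foppE, fsubE); ring.
- by move=> k; apply: order_lt0; exact: ad_eta.
Qed.

End Associative.
End GrothendieckOrder.

(** * Differential operators and their orders *)

Section Operators.
Variables (R : realType) (m : nat) (M : topologicalType).
Variables (A : set (chart R m M)) (hA : smooth_structure A).
Implicit Types (c : chart R m M) (f g h : M -> R[i]) (p q : M).
Implicit Types (D : (M -> R[i]) -> M -> R[i]).

Lemma smooth_mul f g : smooth A f -> smooth A g -> smooth A (f * g).
Proof.
move=> /smoothP sf /smoothP sg; apply/smoothP => c Ac.
by apply: cchart_smoothM; [exact: sf|exact: sg].
Qed.

Lemma smooth_cst (z : R[i]) : smooth A (cst z).
Proof. by apply/smoothP => c _; exact: cchart_smooth_cst. Qed.

Lemma smooth_add f g : smooth A f -> smooth A g -> smooth A (f + g).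
Proof.
move=> /smoothP sf /smoothP sg; apply/smoothP => c Ac.
by apply: cchart_smoothD; [exact: sf|exact: sg].
Qed.

Lemma smooth_sub f g : smooth A f -> smooth A g -> smooth A (f - g).
Proof.
move=> sf sg; have -> : f - g = f + cst (-1) * g.
  by apply/funext => q; rewrite !fctE mulN1r.
by apply: smooth_add => //; apply: smooth_mul => //; exact: smooth_cst.
Qed.

Lemma smooth_1 : smooth A (1 : M -> R[i]).
Proof. exact: (smooth_cst 1). Qed.

(** Only the values at p matter, so the coefficients are constants. *)
Definition has_jet c p D :=
  exists l, forall f, smooth A f -> D f p = jet c l f p.

Definition diff_op c (U : set M) D :=
  (forall f, smooth A f -> smooth A (D f)) /\ forall p, U p -> has_jet c p D.

(** By the iterated Leibniz rule the class of jets is stable under f |-> h f. *)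
Lemma has_jet_ad c p D h : A c -> cdom c p -> smooth A h ->
  has_jet c p D -> has_jet c p (ad h D).
Proof.
move=> Ac cp sh [l Hl].
exists ([seq (b.1 * iter_cdchart c u.1 h p, u.2) | b <- l, u <- splits b.2]
   ++ [seq (- h p * b.1, b.2) | b <- l]) => f sf.
have ch : cchart_smooth c h by move/smoothP: sh; apply.
have cf : cchart_smooth c f by move/smoothP: sf; apply.
rewrite adE !Hl //; last exact: smooth_mul.
rewrite /jet big_cat big_allpairs_dep big_map /=; congr (_ + _).
  apply: eq_bigr => b _; rewrite iter_cdchartM // mulr_sumr.
  by apply: eq_bigr => u _; rewrite mulrA.
rewrite mulr_sumr -sumrN; apply: eq_bigr => b _.
by rewrite !mulNr mulrA.
Qed.

Section OnChart.
Variables (c : chart R m M) (U : set M).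
Hypotheses (Ac : A c) (oU : open U) (Uc : U `<=` cdom c).

Lemma diff_op_ad h D : smooth A h -> diff_op c U D -> diff_op c U (ad h D).
Proof.
move=> sh [sD jD]; split.
  move=> f sf; apply: smooth_sub; first by apply: sD; exact: smooth_mul.
  by apply: smooth_mul => //; exact: sD.
by move=> p Up; apply: has_jet_ad => //; [exact: Uc|exact: jD].
Qed.

Lemma diff_op_lin D (a b : R[i]) f g p : diff_op c U D -> U p ->
  smooth A f -> smooth A g ->
  D (cst a * f + cst b * g) p = a * D f p + b * D g p.
Proof.
move=> [sD jD] Up sf sg; have [l Hl] := jD p Up.
have cf : cchart_smooth c f by move/smoothP: sf; apply.
have cg : cchart_smooth c g by move/smoothP: sg; apply.
rewrite !Hl // ?jet_lin //; first exact: Uc.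
by apply: smooth_add; apply: smooth_mul => //; exact: smooth_cst.
Qed.

Lemma nearU p f g : U p -> (forall q, U q -> f q = g q) ->
  \forall q \near p, f q = g q.
Proof.
move=> Up fg; have nU : \forall q \near p, U q by apply: open_nbhs_nbhs; split.
by apply: filterS nU.
Qed.

Lemma diff_op_local D : diff_op c U D -> local_op (smooth A) U D.
Proof.
move=> gD; have [sD jD] := gD.
have DB f g : smooth A f -> smooth A g -> forall p, U p -> D (f - g) p = D f p - D g p.
  move=> sf sg p Up.
  have -> : f - g = cst 1 * f + cst (-1) * g.
    by apply/funext => q; rewrite !fctE mul1r mulN1r.
  by rewrite diff_op_lin // mul1r mulN1r.
split=> // f sf f0 p Up.
have -> : D f p = D (f - f) p.
  have [l Hl] := jD p Up; rewrite !Hl //; last exact: smooth_sub.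
  apply: jet_near; first exact: Uc.
  by apply: nearU => // q Uq; rewrite !fctE f0 // subrr.
by rewrite DB // subrr.
Qed.

Lemma ad_lin D (a b : R[i]) h h' : diff_op c U D -> smooth A h -> smooth A h' ->
  eq_on (smooth A) U (ad (cst a * h + cst b * h') D)
    (fun f => cst a * ad h D f + cst b * ad h' D f).
Proof.
move=> gD sh sh' f sf p Up.
rewrite faddE !fmulE !adE faddE !fmulE.
have -> : (cst a * h + cst b * h') * f = cst a * (h * f) + cst b * (h' * f).
  by rewrite mulrDl !mulrA.
by rewrite diff_op_lin //; [rewrite /cst; ring|exact: smooth_mul..].
Qed.

Hypothesis ext : forall f, cchart_smooth c f -> exists2 F, smooth A F & forall q, U q -> F q = f q.
Variable X : 'I_m -> M -> R[i].
Hypothesis SX : forall i, smooth A (X i).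
Hypothesis EX : forall i q, U q -> X i q = (cmap c q 0 i)%:C.

(** As [ad h] commutes with [ad (X i)], induction reduces the claim to k = 0: a
    differential operator that commutes with all coordinates commutes with all
    multiplications.  At a given point this is [jet_scalar]. *)
Lemma order_lt_coordinates k D : diff_op c U D ->
  (forall i, order_lt (smooth A) U k (ad (X i) D)) -> order_lt (smooth A) U k.+1 D.
Proof.
elim: k D => [|k IH] D gD H; last first.
  move=> h sh; apply: IH; first exact: diff_op_ad.
  by move=> i; rewrite adC; exact: (H i h sh).
move=> h sh f sf p Up; have cp := Uc Up.
have [l Hl] := (proj2 gD) p Up.
have [i g sg|z Hz] := jet_scalar (l := l) cp.
  have [G SG EG] := ext sg.
  (* near p, x_i g is X_i G - X_i(p) G, where G extends g *)
  transitivity (D (cst 1 * (X i * G) + cst (- X i p) * G) p).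
    rewrite Hl; last first.
      apply: smooth_add; apply: smooth_mul; try exact: smooth_cst => //.
        exact: smooth_mul.
      by [].
    apply: jet_near => //; apply: nearU => // q Uq.
    by rewrite !fctE EG // /centred_coord !EX // raddfB /=; ring.
  rewrite diff_op_lin //; last exact: smooth_mul.
  by rewrite mul1r mulNr; have := H i G SG p Up; rewrite adE.
have cc F : smooth A F -> cchart_smooth c F by move=> /smoothP; apply.
rewrite adE !Hl //; last exact: smooth_mul.
rewrite !Hz; [|exact: cc|by apply: cchart_smoothM; exact: cc].
by rewrite fmulE mulrCA subrr.
Qed.

End OnChart.

(** Coordinates centred at p and f extend to global functions that agree with them
    near p, and [order_lt_vanish] applies to these. *)
Lemma order_lt_jet_component c p (V : set M) k D l : A c -> cdom c p -> V p ->
  order_lt (smooth A) V k D -> (forall f, smooth A f -> D f p = jet c l f p) ->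
  forall d f, (k <= d)%N -> smooth A f -> jet_component c d l f p = 0.
Proof.
move=> Ac cp Vp HD Hl d f kd /smoothP /(_ c Ac) cf.
have [N lN] := jet_bounded l.
apply: (jet_truncate cp lN (r := k)) => // e g se sg.
have [U [oU Up Uc ext]] := smooth_extension hA Ac cp.
pose X i := s2val (cid2 (ext _ (cchart_smooth_centred_coord c p i))).
have SX i : smooth A (X i) := s2valP (cid2 (ext _ (cchart_smooth_centred_coord c p i))).
have EX i : forall q, U q -> X i q = centred_coord c p i q :=
  s2valP' (cid2 (ext _ (cchart_smooth_centred_coord c p i))).
have [G SG EG] := ext _ sg.
have X0 i : X i p = 0 by rewrite EX // /centred_coord subrr.
rewrite -(order_lt_vanish SX X0 HD Vp SG se) Hl; last first.
  by elim: (e) => //= i e' IH; exact: smooth_mul.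
apply: jet_near => //; apply: (nearU oU) => // q Uq.
elim: (e) => [|i e' IH] /=; first by rewrite EG.
by rewrite !fmulE IH EX.
Qed.

End Operators.

(** * Truncation of coordinate expressions *)

Section Words.
Variables (m : nat) (V : nmodType).
Implicit Types (F : seq 'I_m -> V).

Definition words K : seq (seq 'I_m) :=
  [seq val s | i <- enum 'I_K, s <- enum {: (nat_of_ord i).-tuple 'I_m}].

Lemma big_words K F :
  \sum_(s <- words K) F s = \sum_(i < K) \sum_(s : i.-tuple 'I_m) F s.
Proof.
rewrite big_allpairs_dep big_enum; apply: eq_bigr => i _ /=.
by rewrite big_enum.
Qed.

Lemma big_words_size K F (d : nat) : (d < K)%N ->
  \sum_(s <- words K | size s == d) F s = \sum_(s : d.-tuple 'I_m) F s.
Proof.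
move=> dK; rewrite big_mkcond big_words (bigD1 (Ordinal dK)) //= [X in _ + X]big1 ?addr0.
  by apply: eq_bigr => s _; rewrite size_tuple eqxx.
move=> i iN; rewrite big1 // => s _; rewrite size_tuple.
by move: iN; rewrite -val_eqE => /negbTE /= ->.
Qed.

(** The test on the length of s accounts for K < r. *)
Lemma words_truncate K r F :
  (forall d, (r <= d)%N -> \sum_(s <- words K | size s == d) F s = 0) ->
  \sum_(s <- words K) F s = \sum_(s <- words r) (if (size s < K)%N then F s else 0).
Proof.
move=> H; rewrite !big_words.
pose N := maxn K r.
rewrite (big_ord_widen N (fun i => \sum_(s : i.-tuple 'I_m) F s)) ?leq_maxl //.
rewrite (big_ord_widen N (fun i => \sum_(s : i.-tuple 'I_m)
  (if (size s < K)%N then F s else 0))) ?leq_maxr //.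
rewrite big_mkcond [RHS]big_mkcond; apply: eq_bigr => i _ /=.
case: (ltnP i r) => [ir|ri]; last first.
  by case: ifP => // iK; rewrite -(big_words_size _ iK) H.
case: ifP => iK; first by apply: eq_bigr => s _; rewrite size_tuple iK.
by rewrite big1 // => s _; rewrite size_tuple iK.
Qed.

End Words.

Section Truncation.
Variables (R : realType) (m : nat) (M : topologicalType).
Variables (A : set (chart R m M)) (hA : smooth_structure A).

Lemma order_lt_truncate c p (V : set M) k K D (cf : seq 'I_m -> R[i]) :
  A c -> cdom c p -> V p -> order_lt (smooth A) V k D ->
  (forall f, smooth A f -> D f p = \sum_(s <- words m K) cf s * iter_cdchart c s f p) ->
  forall f, smooth A f -> D f p =
    \sum_(s <- words m k) (if (size s < K)%N then cf s else 0) * iter_cdchart c s f p.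
Proof.
move=> Ac cp Vp HD HE f sf.
pose l := [seq (cf s, s) | s <- words m K].
have Hl g : smooth A g -> D g p = jet c l g p.
  by move=> sg; rewrite HE // /jet big_map.
rewrite HE // (@words_truncate _ _ K k).
  by apply: eq_bigr => s _; case: ifP => // _; rewrite mul0r.
move=> d kd; have := order_lt_jet_component hA Ac cp Vp HD Hl kd sf.
by rewrite /jet_component big_map.
Qed.

Lemma bidiff_exprE (c : chart R m M) (V : set M) k l B :
  bidiff_expr A c V k l B <->
  exists a : seq 'I_m -> seq 'I_m -> M -> R[i],
    (forall s t, csmooth_in_chart c V (a s t)) /\
    (forall f h, smooth A f -> smooth A h -> forall p, V p ->
      B f h p = \sum_(s <- words m k.+1) \sum_(t <- words m l.+1)
        a s t p * iter_cdchart c s f p * iter_cdchart c t h p).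
Proof.
have E a f h p : \sum_(s <- words m k.+1) \sum_(t <- words m l.+1)
        a s t p * iter_cdchart c s f p * iter_cdchart c t h p =
    \sum_(i < k.+1) \sum_(s : i.-tuple 'I_m)
          \sum_(j < l.+1) \sum_(t : j.-tuple 'I_m)
            a s t p * iter_cdchart c s f p * iter_cdchart c t h p :> R[i].
  rewrite big_words; apply: eq_bigr => i _; apply: eq_bigr => s _.
  by rewrite big_words.
split=> -[a [sa Ha]]; exists a; split=> // f h sf sh p Vp.
  by rewrite E; exact: Ha.
by rewrite -E; exact: Ha.
Qed.

Lemma csmooth_in_chart_sub (c : chart R m M) (V V' : set M) f :
  V' `<=` V -> csmooth_in_chart c V f -> csmooth_in_chart c V' f.
Proof.
move=> sV [H1 H2]; split; [move: H1|move: H2] => H s y;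
  by move=> [q [/sV Vq cq] <-]; apply: H; exists q.
Qed.

Lemma csmooth_in_chart_0 (c : chart R m M) (V : set M) :
  csmooth_in_chart c V (cst 0).
Proof.
by split; apply/smooth_onP => k; exact: Ck_cst.
Qed.

(** For fixed h, f |-> B f h has a jet at each point and [order_lt_truncate] removes
    its high derivatives; then the same is done for fixed f in the other argument. *)
Lemma bidiff_truncate (c : chart R m M) (V V' U : set M) k l r B :
  A c -> V' `<=` V -> V' `<=` U -> V' `<=` cdom c ->
  bidiff_expr A c V k l B ->
  (forall f, smooth A f -> order_lt (smooth A) U r.+1 (B f)) ->
  (forall h, smooth A h -> order_lt (smooth A) U r.+1 (fun f => B f h)) ->
  bidiff_expr A c V' r r B.
Proof.
move=> Ac sV sU sc /bidiff_exprE [a [sa Ha]] Hl Hr; apply/bidiff_exprE.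
pose a1 s t := if (size s < k.+1)%N then a s t else cst 0.
exists (fun s t => if (size t < l.+1)%N then a1 s t else cst 0); split.
  move=> s t; rewrite /a1; case: ifP => _; last exact: csmooth_in_chart_0.
  case: ifP => _; last exact: csmooth_in_chart_0.
  exact: csmooth_in_chart_sub (sa s t).
move=> f h sf sh p V'p.
have Vp := sV _ V'p; have Up := sU _ V'p; have cp := sc _ V'p.
have E1 f' h' : smooth A f' -> smooth A h' -> B f' h' p =
    \sum_(s <- words m r.+1) \sum_(t <- words m l.+1)
      a1 s t p * iter_cdchart c s f' p * iter_cdchart c t h' p.
  move=> sf' sh'.
  rewrite (@order_lt_truncate c p U r.+1 k.+1 (fun f => B f h')
    (fun s => \sum_(t <- words m l.+1) a s t p * iter_cdchart c t h' p)) //.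
  - apply: eq_bigr => s _; rewrite /a1; case: ifP => _.
      by rewrite mulr_suml; apply: eq_bigr => t _; rewrite mulrAC.
    by rewrite mul0r big1 // => t _; rewrite /cst !mul0r.
  - exact: Hr.
  - move=> f0 sf0; rewrite Ha //; apply: eq_bigr => s _.
    by rewrite mulr_suml; apply: eq_bigr => t _; rewrite mulrAC.
rewrite (@order_lt_truncate c p U r.+1 l.+1 (B f)
  (fun t => \sum_(s <- words m r.+1) a1 s t p * iter_cdchart c s f p)) //.
- rewrite exchange_big /=; apply: eq_bigr => t _; case: ifP => _.
    by rewrite mulr_suml.
  by rewrite mul0r big1 // => s _; rewrite /cst !mul0r.
- exact: Hl.
- move=> h0 sh0; rewrite E1 // exchange_big; apply: eq_bigr => t _.
  by rewrite mulr_suml.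
Qed.

End Truncation.

(** * Coefficients of a star product *)

Section StarProduct.
Variables (R : realType) (n : nat) (M : topologicalType).
Variables (A : set (chart R (n + n) M)) (g I : chart R (n + n) M -> M -> 'M[R]_(n + n)).
Hypothesis hA : smooth_structure A.
Implicit Types (f h : M -> R[i]).

Lemma fsmooth_fconst f : smooth A f -> fsmooth A (fconst f).
Proof.
move=> sf [|r]; first by have -> : fconst f 0 = f by apply/funext.
have -> : fconst f r.+1 = cst 0 by apply/funext.
exact: smooth_cst.
Qed.

Section Coefficients.
Variable star : fseries R M -> fseries R M -> fseries R M.
Hypothesis hS : star_product A g I star.

Local Notation C := (star_coef star).

Lemma smooth_coef r f h : smooth A f -> smooth A h -> smooth A (C r f h).
Proof. by move=> sf sh; apply: (star_smooth hS); exact: fsmooth_fconst. Qed.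

(** The formal parameter. *)
Definition nu : nat -> R[i] := fun i => (i == 1%N)%:R.

Lemma fscale_nu (F : fseries R M) r p :
  fscale nu F r p = if r is r'.+1 then F r' p else 0.
Proof.
rewrite /fscale /nu; case: r => [|r].
  by rewrite big_ord_recl big_ord0 mul0r addr0.
rewrite 2!big_ord_recl big1 ?addr0 /=.
  by rewrite mul0r add0r mul1r subSS subn0.
by move=> i _; rewrite mul0r.
Qed.

Lemma fseries_split (F : fseries R M) :
  F = fadd (fscale nu (fun r => F r.+1)) (fconst (F 0%N)).
Proof.
apply/funext => r; apply/funext => p; rewrite /fadd fscale_nu /fconst.
by case: r => [|r] /=; rewrite ?add0r ?addr0.
Qed.

(** The series G is nu G' + G_0 with G' its shift ([fseries_split]), and the product
    is linear over formal series. *)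
Lemma star_expandr r f (G : fseries R M) p : smooth A f -> fsmooth A G ->
  star (fconst f) G r p = \sum_(s < r.+1) C (r - s) f (G s) p.
Proof.
move=> sf; elim: r G => [|r IH] G sG; rewrite {1}[G]fseries_split;
  rewrite (star_linearr hS) ?{1}/fadd ?fscale_nu; try exact: fsmooth_fconst;
  try (by move=> s; exact: sG).
  by rewrite big_ord_recl big_ord0 addr0 add0r.
rewrite IH; last by move=> s; exact: sG.
by rewrite [RHS]big_ord_recl addrC; congr (_ + _).
Qed.

Lemma star_expandl r h (G : fseries R M) p : smooth A h -> fsmooth A G ->
  star G (fconst h) r p = \sum_(s < r.+1) C (r - s) (G s) h p.
Proof.
move=> sh; elim: r G => [|r IH] G sG; rewrite {1}[G]fseries_split;
  rewrite (star_linearl hS) ?{1}/fadd ?fscale_nu; try exact: fsmooth_fconst;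
  try (by move=> s; exact: sG).
  by rewrite big_ord_recl big_ord0 addr0 add0r.
rewrite IH; last by move=> s; exact: sG.
by rewrite [RHS]big_ord_recl addrC; congr (_ + _).
Qed.

Lemma coef_assoc r f f' h p : smooth A f -> smooth A f' -> smooth A h ->
  \sum_(s < r.+1) C (r - s) f (C s f' h) p = \sum_(s < r.+1) C (r - s) (C s f f') h p.
Proof.
move=> sf sf' sh.
have := congr1 (fun F : fseries R M => F r p)
  (star_assoc hS (fsmooth_fconst sf) (fsmooth_fconst sf') (fsmooth_fconst sh)).
rewrite star_expandr //; last by move=> s; exact: smooth_coef.
by rewrite star_expandl //; move=> s; exact: smooth_coef.
Qed.

Lemma coef_jet r c p f : A c -> cdom c p -> smooth A f ->
  has_jet A c p (C r f) /\ has_jet A c p (fun h => C r h f).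
Proof.
move=> Ac cp sf.
have [V [k [l [oV Vp Vc /bidiff_exprE [a [_ Ha]]]]]] := star_bidiff hS r Ac cp.
split.
  exists [seq (\sum_(s <- words (n + n) k.+1) a s t p * iter_cdchart c s f p, t)
     | t <- words (n + n) l.+1] => h sh.
  rewrite Ha // /jet big_map exchange_big; apply: eq_bigr => t _.
  by rewrite mulr_suml.
exists [seq (\sum_(t <- words (n + n) l.+1) a s t p * iter_cdchart c t f p, s)
   | s <- words (n + n) k.+1] => h sh.
rewrite Ha // /jet big_map; apply: eq_bigr => s _.
by rewrite mulr_suml; apply: eq_bigr => t _; rewrite mulrAC.
Qed.

Lemma vey_of_order_lt :
  (forall p, exists U, [/\ open U, U p &
    forall r f, smooth A f -> order_lt (smooth A) U r.+1 (C r f) /\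
      order_lt (smooth A) U r.+1 (fun h => C r h f)]) -> vey_type A star.
Proof.
move=> H r c p Ac cp; have [U [oU Up HU]] := H p.
have [V [k [l [oV Vp Vc He]]]] := star_bidiff hS r Ac cp.
exists (V `&` U); split => //; first exact: openI.
  by move=> q [/Vc].
apply: (bidiff_truncate hA Ac _ _ _ He (U := U)).
- by move=> q [].
- by move=> q [].
- by move=> q [/Vc].
- by move=> f /HU - /(_ r) [].
- by move=> f /HU - /(_ r) [].
Qed.

(** Linear combinations of the zeta and eta give the real coordinates X, for which
    [order_lt_coordinates] holds. *)
Lemma coef_order_lt c (U : set M) (X : 'I_(n + n) -> M -> R[i])
    (zeta eta : 'I_n -> M -> R[i]) (a b : 'I_(n + n) -> R[i]) (k : 'I_(n + n) -> 'I_n) :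
  A c -> open U -> U `<=` cdom c ->
  (forall f, cchart_smooth c f -> exists2 F, smooth A F & forall q, U q -> F q = f q) ->
  (forall i, smooth A (X i)) -> (forall i q, U q -> X i q = (cmap c q 0 i)%:C) ->
  (forall i, smooth A (zeta i)) -> (forall i, smooth A (eta i)) ->
  (forall i, X i = cst (a i) * zeta (k i) + cst (b i) * eta (k i)) ->
  (forall r i f, smooth A f -> forall p, U p -> C r.+1 f (zeta i) p = 0) ->
  (forall r i f, smooth A f -> forall p, U p -> C r.+1 (eta i) f p = 0) ->
  forall r f, smooth A f -> order_lt (smooth A) U r.+1 (C r f) /\
      order_lt (smooth A) U r.+1 (fun h => C r h f).
Proof.
move=> Ac oU Uc ext SX EX Sz Se XE Cz Ce r f sf.
apply: (@order_lt_coefficients _ _ (smooth A) U (@smooth_mul _ _ _ A) (@smooth_sub _ _ _ A)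
  (@smooth_1 _ _ _ A) C _ _ zeta eta (diff_op A c U)) => //.
- by move=> D; exact: diff_op_local.
- by move=> h D; exact: diff_op_ad.
- move=> k' D gD Hz He; apply: (order_lt_coordinates Ac oU Uc ext SX EX gD) => i.
  have E : eq_on (smooth A) U (fun f => cst (a i) * ad (zeta (k i)) D f
      + cst (b i) * ad (eta (k i)) D f) (ad (X i) D).
    by move=> f' sf' q Uq; rewrite XE (ad_lin Ac Uc).
  have SM := @smooth_mul _ _ _ A.
  have Gz := order_ltZ SM (cst (a i)) (Hz (k i)).
  have Ge := order_ltZ SM (cst (b i)) (He (k i)).
  exact: (order_lt_eq_on SM E (order_ltD SM Gz Ge)).
- move=> r' h sh; split; first by move=> f' sf'; exact: smooth_coef.
  by move=> q Uq; exact: (proj1 (coef_jet r' Ac (Uc _ Uq) sh)).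
- move=> r' h sh; split; first by move=> f' sf'; exact: smooth_coef.
  by move=> q Uq; exact: (proj2 (coef_jet r' Ac (Uc _ Uq) sh)).
- by move=> f1 f2 s1 s2 q _; exact: (star_coef0 hS).
- by move=> r' f1 f2 f3 s1 s2 s3 q _; exact: coef_assoc.
Qed.

End Coefficients.

End StarProduct.

(** * Holomorphic coordinates *)

Section HolomorphicCoordinates.
Variables (R : realType) (n : nat) (M : topologicalType).
Variables (A : set (chart R (n + n) M)) (I : chart R (n + n) M -> M -> 'M[R]_(n + n)).
Hypothesis hI : endomorphism_field A I.

(** The Jacobian of the transition between two holomorphic charts commutes with the
    standard complex structure. *)
Lemma cauchy_riemann (c c' : chart R (n + n) M) p (k l : 'I_n) :
  A c -> A c' -> holomorphic_chart I c -> holomorphic_chart I c' ->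
  cdom c p -> cdom c' p ->
  Defs.jacobian c c' p (rshift n l) (rshift n k) = Defs.jacobian c c' p (lshift n l) (lshift n k) /\
  Defs.jacobian c c' p (lshift n l) (rshift n k) = - Defs.jacobian c c' p (rshift n l) (lshift n k).
Proof.
move=> Ac Ac' hc hc' cp c'p; have := ef_tensor hI Ac Ac' cp c'p.
rewrite hc // hc' // /std_complex_structure; move: (Defs.jacobian c c' p) => J.
rewrite -[J]submxK; move: (ulsubmx J) (ursubmx J) (dlsubmx J) (drsubmx J) => a b d e.
rewrite !mulmx_block !(mulmx0, mulmx1, mul0mx, mul1mx, add0r, addr0, mulmxN, mulNmx).
by move=> /eq_block_mx [-> _ -> _];
  rewrite !block_mxEul !block_mxEur !block_mxEdl !block_mxEdr !mxE ?opprK.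
Qed.

Lemma sum_Zvec (k : 'I_n) (v : 'I_(n + n) -> R[i]) :
  \sum_j Zvec R k j 0 * v j = 2^-1 * (v (lshift n k) - 'i%C * v (rshift n k)).
Proof.
rewrite (bigD1 (lshift n k)) // (bigD1 (rshift n k)) ?eq_rlshift //= big1 ?addr0.
  by rewrite !mxE !eqxx eq_rlshift eq_lrshift /=; ring.
move=> j /andP[jl jr]; rewrite !mxE (negbTE jl) (negbTE jr) /=; ring.
Qed.

Lemma sum_Zbarvec (k : 'I_n) (v : 'I_(n + n) -> R[i]) :
  \sum_j Zbarvec R k j 0 * v j = 2^-1 * (v (lshift n k) + 'i%C * v (rshift n k)).
Proof.
rewrite (bigD1 (lshift n k)) // (bigD1 (rshift n k)) ?eq_rlshift //= big1 ?addr0.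
  by rewrite !mxE !eqxx eq_rlshift eq_lrshift /=; ring.
move=> j /andP[jl jr]; rewrite !mxE (negbTE jl) (negbTE jr) /=; ring.
Qed.

Variables (c : chart R (n + n) M) (U : set M) (X : 'I_(n + n) -> M -> R[i]).
Hypotheses (Ac : A c) (hc : holomorphic_chart I c) (oU : open U) (Uc : U `<=` cdom c).
Hypothesis SX : forall i, smooth A (X i).
Hypothesis EX : forall i q, U q -> X i q = (cmap c q 0 i)%:C.

(** The X are the real coordinates, extended to M, and z = x + i y on U. *)
Definition zcoord (l : 'I_n) := X (lshift n l) + cst 'i%C * X (rshift n l).
Definition zbarcoord (l : 'I_n) := X (lshift n l) + cst (- 'i%C) * X (rshift n l).

Lemma smooth_zcoord l : smooth A (zcoord l).
Proof. by apply: smooth_add => //; apply: smooth_mul => //; exact: smooth_cst. Qed.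

Lemma smooth_zbarcoord l : smooth A (zbarcoord l).
Proof. by apply: smooth_add => //; apply: smooth_mul => //; exact: smooth_cst. Qed.

Lemma cdchart_X c' i j p : A c' -> U p -> cdom c' p ->
  cdchart c' j (X i) p = (Defs.jacobian c' c p i j)%:C.
Proof.
move=> Ac' Up c'p.
have -> : cdchart c' j (X i) p = cdchart c' j (fun q => (cmap c q 0 i)%:C) p.
  by apply: cdchart_near => //; apply: (nearU oU) => // q; exact: EX.
by rewrite /cdchart /= mxE dchart_cst.
Qed.

Lemma cdchart_zcoord c' (z : R[i]) l j p : A c' -> U p -> cdom c' p ->
  cdchart c' j (X (lshift n l) + cst z * X (rshift n l)) p =
    (Defs.jacobian c' c p (lshift n l) j)%:C + z * (Defs.jacobian c' c p (rshift n l) j)%:C.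
Proof.
move=> Ac' Up c'p.
have cX i : cchart_smooth c' (X i) by move/smoothP: (SX i); apply.
rewrite cdchartD ?cdchartM //; first by rewrite !cdchart_X // cdchart_cst mul0r add0r.
  exact: cchart_smooth_cst.
by apply: cchart_smoothM => //; exact: cchart_smooth_cst.
Qed.

Lemma holomorphic_zcoord l : holomorphic_on A I U (zcoord l).
Proof.
move=> c' Ac' hc' p Up c'p k.
rewrite /Zbarder sum_Zbarvec !cdchart_zcoord //.
have [E1 E2] := cauchy_riemann k l Ac' Ac hc' hc c'p (Uc Up).
rewrite E1 E2; apply/eqP; rewrite eq_complex /=; apply/andP; split; apply/eqP; ring.
Qed.

Lemma antiholomorphic_zbarcoord l : antiholomorphic_on A I U (zbarcoord l).
Proof.
move=> c' Ac' hc' p Up c'p k.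
rewrite /Zder sum_Zvec !cdchart_zcoord //.
have [E1 E2] := cauchy_riemann k l Ac' Ac hc' hc c'p (Uc Up).
rewrite E1 E2; apply/eqP; rewrite eq_complex /=; apply/andP; split; apply/eqP; ring.
Qed.

(** The index k of the complex coordinate z_k = x_k + i y_k to which the i-th real
    coordinate belongs. *)
Definition pair_index (i : 'I_(n + n)) : 'I_n :=
  match fintype.split i with inl k => k | inr k => k end.

(** x = (z + zbar) / 2 and y = (z - zbar) / (2 i). *)
Definition zcoef (i : 'I_(n + n)) : R[i] :=
  match fintype.split i with inl _ => 2^-1 | inr _ => - (2^-1 * 'i%C) end.

Definition zbarcoef (i : 'I_(n + n)) : R[i] :=
  match fintype.split i with inl _ => 2^-1 | inr _ => 2^-1 * 'i%C end.

Lemma real_coord i : X i =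
  cst (zcoef i) * zcoord (pair_index i) + cst (zbarcoef i) * zbarcoord (pair_index i).
Proof.
have i2 : 'i%C * 'i%C = -1 :> R[i].
  by apply/eqP; rewrite eq_complex /=; apply/andP; split; apply/eqP; ring.
have h2 : 2^-1 + 2^-1 = 1 :> R[i] by rewrite [RHS](splitr 1) mul1r.
apply/funext => q; rewrite faddE !fmulE /zcoord /zbarcoord !faddE !fmulE.
rewrite /cst /zcoef /zbarcoef /pair_index -{1}(fintype.splitK i); case: (fintype.split i) => k /=.
  transitivity ((2^-1 + 2^-1) * X (lshift n k) q); first by rewrite h2 mul1r.
  ring.
transitivity (- ('i%C * 'i%C) * (2^-1 + 2^-1) * X (rshift n k) q).
  by rewrite h2 i2 opprK !mul1r.
ring.
Qed.

End HolomorphicCoordinates.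

Theorem mainTheorem6 (R : realType) (n : nat) (M : topologicalType)
    (A : set (chart R (n + n) M)) (g I : chart R (n + n) M -> M -> 'M[R]_(n + n))
    (hA : smooth_structure A) (hK : pseudo_kaehler A g I) :
  (forall star : fseries R M -> fseries R M -> fseries R M,
      star_product A g I star -> wick_type A I star -> vey_type A star) /\
  (forall star : fseries R M -> fseries R M -> fseries R M,
      star_product A g I star -> antiwick_type A I star -> vey_type A star).
Proof.
split=> star hS hW; apply: (vey_of_order_lt hA hS) => p.
all: have [c [Ac cp hc]] := pk_complex hK p.
all: have [U [oU Up Uc ext]] := smooth_extension hA Ac cp.
all: pose X i := s2val (cid2 (ext _ (cchart_smooth_coord c i))).
all: have SX i : smooth A (X i) := s2valP (cid2 (ext _ (cchart_smooth_coord c i))).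
all: have EX i : forall q, U q -> X i q = (cmap c q 0 i)%:C :=
  s2valP' (cid2 (ext _ (cchart_smooth_coord c i))).
all: have Sz := smooth_zcoord SX.
all: have Sb := smooth_zbarcoord SX.
all: have Hz := holomorphic_zcoord (pk_field hK) Ac hc oU Uc SX EX.
all: have Hb := antiholomorphic_zbarcoord (pk_field hK) Ac hc oU Uc SX EX.
all: exists U; split => //.
- apply: (coef_order_lt hS Ac oU Uc ext SX EX Sz Sb (real_coord X)) => r i f sf q Uq.
    by have [+ _] := hW U f f _ _ oU sf sf (Sz i) (Sb i) (Hz i) (Hb i); apply.
  by have [_ +] := hW U f f _ _ oU sf sf (Sz i) (Sb i) (Hz i) (Hb i); apply.
(* anti-Wick type: z and zbar change places *)
- have XE i : X i = cst (zbarcoef R i) * zbarcoord X (pair_index i)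
      + cst (zcoef R i) * zcoord X (pair_index i).
    by rewrite addrC; exact: real_coord.
  apply: (coef_order_lt hS Ac oU Uc ext SX EX Sb Sz XE) => r i f sf q Uq.
    by have [_ +] := hW U f f _ _ oU sf sf (Sz i) (Sb i) (Hz i) (Hb i); apply.
  by have [+ _] := hW U f f _ _ oU sf sf (Sz i) (Sb i) (Hz i) (Hb i); apply.
Qed.
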